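(* Let $k\geq 1$ be an integer. There exists $s_0=s_0(k)$ such that for every integer $s\geq s_0$, every graph $G$ which contains no copy of $K_{s,s}$ as a subgraph and has average degree at least $s^{1000k^2}$ contains an induced subgraph which contains no copy of $C_4$ (as a subgraph) and has average degree at least $k$.
   Context: $K_{s,s}$ is the complete bipartite graph with both parts of size $s$, and $C_4$ is the cycle of length $4$. *)

(* Defs.v *)
(* A (finite simple) graph is a symmetric irreflexive
   relation e on a finite type T of vertices. *)
From mathcomp Require Import all_boot.
Set Implicit Arguments. Unset Strict Implicit. Unset Printing Implicit Defensive.

Definition deg_in (T : finType) (e : rel T) (A : {set T}) (x : T) : nat :=
  #|[set y in A | e x y]|.

Definition avgdeg_ge (T : finType) (e : rel T) (d : nat) (A : {set T}) : Prop :=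
  A != set0 /\ d * #|A| <= \sum_(x in A) deg_in e A x.

Definition has_Kss (T : finType) (e : rel T) (s : nat) : Prop :=
  exists X Y : {set T},
    [/\ #|X| = s, #|Y| = s, [disjoint X & Y] &
        forall x y, x \in X -> y \in Y -> e x y].

Definition has_C4_in (T : finType) (e : rel T) (A : {set T}) : Prop :=
  exists a b c d : T,
    [/\ [&& a \in A, b \in A, c \in A & d \in A],
        uniq [:: a; b; c; d] &
        [&& e a b, e b c, e c d & e d a]].

(* Main.v *)
(* We look for k-regular-on-one-side bipartite incidence structures: a family of k-subsets of a
   vertex set, pairwise meeting in at most one point, each realised by a vertex adjacent to exactly
   that subset, gives an induced C4-free subgraph of large average degree.

   If G contains a dense pair (X, Y) with parts of size s^(100k^2), dependent random choice gives many
   vertices of X all of whose k-tuples have a large common neighbourhood; as G has no K_{s,s}, a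
   typical independent tuple x has, for every index set I, many vertices adjacent to exactly
   (x_i)_{i in I}, and the lines of a linear design can be realised.

   Otherwise every dense pair is small. Let D be the maximal average degree of an induced subgraph,
   attained on S, and split S into the vertices of degree more than L*D and the others. If enough
   edges lie among the latter, the graph there is almost regular with few 4-cycles, and a random
   sample with its 4-cycles deleted works. Else there is a very unbalanced pair (A, B) in which the
   vertices of A have about D neighbours in B. If many k-tuples of neighbours are spread (pairwise
   small codegree), sampling B works. If not, most pairs are rich (large codegree), and by iteration
   most k-tuples inside one neighbourhood N of size about D have a common neighbourhood of size at
   least D; since small sets do not form dense pairs, the exact-adjacency argument now loses only a
   constant factor, and a linear design is realised on random points of N. *)
Require Import Defs.
From mathcomp Require Import all_boot.
From mathcomp Require Import all_algebra all_field.
From mathcomp Require Import zify.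
Set Implicit Arguments. Unset Strict Implicit. Unset Printing Implicit Defensive.

(** * Double counting, averaging and union bounds *)

Lemma leq_exp2rw m n j : m <= n -> m ^ j <= n ^ j.
Proof. by case: j => // j mn; rewrite leq_exp2r. Qed.

Lemma sum_card_swap (I J : finType) (P : pred I) (Q : pred J) (r : I -> J -> bool) :
  \sum_(i | P i) #|[set j | Q j & r i j]| = \sum_(j | Q j) #|[set i | P i & r i j]|.
Proof.
under eq_bigr do rewrite -sum1dep_card big_mkcondr.
rewrite exchange_big /=; apply: eq_bigr => j _.
by rewrite -sum1dep_card [RHS]big_mkcondr.
Qed.

(** Averaging: expectations over a random sample are written as sums over the whole sample space,
    and this extracts one favourable outcome. *)
Lemma sum_lt_exists (I : finType) (P : pred I) (F G : I -> nat) :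
  \sum_(i | P i) F i < \sum_(i | P i) G i -> exists2 i, P i & F i < G i.
Proof.
move=> lt; case: (pickP [pred i | P i & F i < G i]) => [i /andP[]|no]; first by exists i.
move: lt; rewrite ltnNge leq_sum // => i Pi.
by move: (no i); rewrite /= Pi /= ltnNge => /negbFE.
Qed.

Lemma card_fiber_le (I J : finType) (A : {set I}) (h : I -> J) (n : nat) :
  (forall z, #|[set x in A | h x == z]| <= n) -> #|A| <= n * #|h @: A|.
Proof.
move=> fib; rewrite -sum1_card (partition_big h (mem (h @: A))) => [|x xA]; last exact: imset_f.
rewrite mulnC -sum_nat_const; apply: leq_sum => z _.
by rewrite sum1dep_card fib.
Qed.

Lemma card_bigcup_le (I T : finType) (P : pred I) (F : I -> {set T}) :
  #|\bigcup_(i | P i) F i| <= \sum_(i | P i) #|F i|.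
Proof.
elim/big_rec2: _ => [|i n A _ IH]; first by rewrite cards0.
by rewrite (leq_trans (leq_card_setU _ _)) // leq_add2l.
Qed.

Lemma subset_of_card (T : finType) (A : {set T}) (n : nat) :
  n <= #|A| -> exists2 B : {set T}, B \subset A & #|B| = n.
Proof.
move=> nA; have /set0Pn [B] : [set B : {set T} | B \subset A & #|B| == n] != set0.
  by rewrite -cards_eq0 cards_draws -lt0n bin_gt0.
by rewrite inE => /andP[BA /eqP]; exists B.
Qed.

(** * Induced bipartite subgraphs and vertices adjacent to almost all of a set *)

Section Graph.
Variables (T : finType) (e : rel T).
Hypothesis (e_sym : symmetric e) (e_irr : irreflexive e).

Definition nbh (A : {set T}) (x : T) : {set T} := [set y in A | e x y].

Definition has_good (k : nat) : Prop :=
  exists A : {set T}, ~ has_C4_in e A /\ avgdeg_ge e k A.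

Lemma sum_nbh_swap (A B : {set T}) :
  \sum_(x in A) #|nbh B x| = \sum_(y in B) #|nbh A y|.
Proof.
rewrite (sum_card_swap (mem A) (mem B) e); apply: eq_bigr => y _.
by apply: eq_card => x; rewrite !inE e_sym.
Qed.

Lemma nbh_sub (A : {set T}) x : nbh A x \subset A.
Proof. by apply/subsetP => y; rewrite inE => /andP[]. Qed.

Lemma nbhS (A B : {set T}) x : A \subset B -> nbh A x \subset nbh B x.
Proof. by move/subsetP => AB; apply/subsetP => y; rewrite !inE => /andP[/AB -> ->]. Qed.

(** A 4-cycle alternates between the parts, so it would give two vertices of [Y] with two common
    neighbours in [X]. Counted from both sides the degree sum is at least [2 * k * #|Y|], and
    [#|X| <= #|Y|] turns this into average degree [k]. *)
Lemma bip_good (k : nat) (X Y : {set T}) : 0 < k -> Y != set0 ->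
  {in X &, forall x x', ~~ e x x'} -> {in Y &, forall y y', ~~ e y y'} ->
  {in Y, forall y, k <= #|nbh X y|} ->
  {in Y &, forall y y', y != y' -> #|nbh X y :&: nbh X y'| <= 1} ->
  #|X| <= #|Y| -> has_good k.
Proof.
move=> k0 Y0 iX iY dY lin leXY; exists (X :|: Y).
have disj : [disjoint X & Y].
  rewrite disjoint_subset; apply/subsetP => x xX; rewrite inE; apply/negP => xY.
  have := leq_trans k0 (dY x xY); case/card_gt0P => z; rewrite inE => /andP[zX].
  by apply/negP; apply: iX.
have adjP x y : x \in X :|: Y -> y \in X :|: Y -> e x y ->
    (x \in X) && (y \in Y) || (x \in Y) && (y \in X).
  rewrite !inE => /orP[xX|xY] /orP[yX|yY] xy.
  - by rewrite (negPf (iX _ _ xX yX)) in xy.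
  - by rewrite xX yY.
  - by rewrite xY yX orbT.
  - by rewrite (negPf (iY _ _ xY yY)) in xy.
have XYF x : x \in X -> x \in Y -> false.
  by move=> xX xY; rewrite (disjointFr disj xX) in xY.
have C4Y y x y' x' : y \in Y -> y' \in Y -> x \in X -> x' \in X -> y != y' -> x != x' ->
    e y x -> e y x' -> e y' x -> e y' x' -> False.
  move=> yY y'Y xX x'X nyy nxx yx yx' y'x y'x'.
  have := lin y y' yY y'Y nyy; rewrite leqNgt => /negP; apply.
  apply/card_gt1P; exists x, x'; rewrite !inE //.
  by rewrite xX x'X yx yx' y'x y'x'.
split.
  move=> [a [b [c [d [/and4P[aA bA cA dA] /= uni /and4P[ab bc cd da]]]]]].
  move: uni; rewrite !inE !negb_or => /and4P[/and3P[nab nac nad] /andP[nbc nbd] ncd _].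
  have := adjP _ _ aA bA ab; have := adjP _ _ bA cA bc; have := adjP _ _ cA dA cd.
  move=> h1 h2 /orP[] /andP[h3 h4].
    case/orP: h2 => /andP[h5 h6]; first by have := XYF _ h5 h4.
    case/orP: h1 => /andP[h7 h8]; last by have := XYF _ h6 h7.
    by apply: (C4Y b a d c) => //; rewrite e_sym.
  case/orP: h2 => /andP[h5 h6]; last by have := XYF _ h4 h5.
  case/orP: h1 => /andP[h7 h8]; first by have := XYF _ h7 h6.
  by apply: (C4Y a b c d) => //; rewrite e_sym.
split; first by apply/set0Pn; case/set0Pn: Y0 => y yY; exists y; rewrite inE yY orbT.
rewrite cardsU disjoint_setI0 // cards0 subn0.
have eqU F : \sum_(x in X :|: Y) F x = \sum_(x in X) F x + \sum_(x in Y) F x :> nat.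
  by rewrite -bigU //=; apply: eq_bigl => x; rewrite !inE.
rewrite eqU.
have sub (Z : {set T}) x : Z \subset X :|: Y -> #|nbh Z x| <= deg_in e (X :|: Y) x.
  by move=> ZU; apply: subset_leq_card; apply: nbhS.
have h1 : \sum_(x in X) #|nbh Y x| <= \sum_(x in X) deg_in e (X :|: Y) x.
  by apply: leq_sum => x _; rewrite sub // subsetUr.
have h2 : \sum_(x in Y) #|nbh X x| <= \sum_(x in Y) deg_in e (X :|: Y) x.
  by apply: leq_sum => x _; rewrite sub // subsetUl.
have h3 : k * #|Y| <= \sum_(x in Y) #|nbh X x|.
  by rewrite mulnC -sum_nat_const; apply: leq_sum => y; apply: dY.
rewrite sum_nbh_swap in h1; nia.
Qed.

(** Any other vertex has at least a fraction [1 / c] of [W] among its non-neighbours, so [W] can be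
    cut down to them at bounded cost. *)
Definition bad_vertices (c : nat) (W : {set T}) : {set T} :=
  [set x | c * #|W :\: nbh W x| < #|W|].

(** Any [s] bad vertices together miss at most half of [W]; the other half, of size at least [s], is
    completely joined to them. *)
Lemma kss_bad (s : nat) (W : {set T}) : ~ has_Kss e s -> 2 * s <= #|W| ->
  #|bad_vertices (2 * s) W| < s.
Proof.
move=> nK sW; rewrite ltnNge; apply/negP => sB.
have [/eqP s0|s0] := posnP s.
  by apply: nK; exists set0, set0; rewrite !cards0 (eqP s0) disjoints_subset sub0set;
    split=> // x y; rewrite inE.
have [X XB cX] := subset_of_card sB.
pose C := W :\: \bigcup_(x in X) (W :\: nbh W x).
have cU : 2 * s * #|\bigcup_(x in X) (W :\: nbh W x)| <= s * #|W|.
  apply: (@leq_trans (\sum_(x in X) 2 * s * #|W :\: nbh W x|)).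
    by rewrite -big_distrr leq_mul2l; apply/orP; right; apply: card_bigcup_le.
  rewrite -cX -sum_nat_const cX; apply: leq_sum => x /(subsetP XB).
  by rewrite inE => /ltnW.
have sC : s <= #|C|.
  have := subset_leq_card (subsetIr W (\bigcup_(x in X) (W :\: nbh W x))).
  rewrite /C cardsD => h; move: cU; rewrite -mulnA mulnCA leq_pmul2l // => cU; lia.
have [Y YC cY] := subset_of_card sC.
have adj x y : x \in X -> y \in Y -> e x y.
  move=> xX /(subsetP YC); rewrite inE => /andP[/bigcupP nU yW].
  apply/negPn/negP => nxy; apply: nU; exists x => //.
  by rewrite !inE yW (negPf nxy).
apply: nK; exists X, Y; split=> //.
rewrite disjoint_subset; apply/subsetP => x xX; rewrite inE; apply/negP => xY.
by have := adj x x xX xY; rewrite e_irr.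
Qed.

End Graph.

(** * Exact adjacency to tuples and realisation of a linear design *)

Section Embedding.
Variables (T : finType) (e : rel T).
Hypothesis (e_sym : symmetric e) (e_irr : irreflexive e).
Notation nbh := (nbh e).

Definition com (Q : finType) (Y : {set T}) (x : {ffun Q -> T}) (I : {set Q}) : {set T} :=
  [set y in Y | [forall p in I, e y (x p)]].

Definition exact (Q : finType) (Y : {set T}) (x : {ffun Q -> T}) (I : {set Q}) : {set T} :=
  [set y in Y | [forall p, e y (x p) == (p \in I)]].

Definition forget (Q : finType) (p : Q) (x : {ffun Q -> T}) : {ffun Q -> option T} :=
  [ffun q => if q == p then None else Some (x q)].

Lemma forgetE (Q : finType) (p : Q) (x x' : {ffun Q -> T}) :
  forget p x = forget p x' -> forall q, q != p -> x q = x' q.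
Proof.
by move=> /ffunP E q qp; move: (E q); rewrite !ffunE (negPf qp) => -[].
Qed.

(** Interpolates between [com] at [r = 0] and [exact] at [r = #|Q|]: non-adjacency is imposed one
    index at a time, in the order of [enum_rank]. *)
Definition com_upto (Q : finType) (Y : {set T}) (I : {set Q}) (r : nat) (x : {ffun Q -> T}) :=
  [set y in com Y x I | [forall p, (p \notin I) && (enum_rank p < r) ==> ~~ e y (x p)]].

Lemma com_upto_forget (Q : finType) (Y : {set T}) (I : {set Q}) p (x x' : {ffun Q -> T}) :
  p \notin I -> forget p x = forget p x' ->
  com_upto Y I (enum_rank p) x = com_upto Y I (enum_rank p) x'.
Proof.
move=> pI /forgetE E; apply/setP => y; rewrite !inE; congr (_ && _ && _).
  apply: eq_forallb => q; case: (boolP (q \in I)) => //= qI; rewrite E //.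
  by apply: contraNneq pI => <-.
apply: eq_forallb => q; case: (boolP (q == p)) => [/eqP ->|qp]; last by rewrite E.
by rewrite ltnn andbF.
Qed.

Lemma in_nonbh (W : {set T}) x y : (y \in W :\: nbh W x) = (y \in W) && ~~ e x y.
Proof. by rewrite !inE; case: (y \in W); rewrite //= andbT. Qed.

(* For fixed I and p, the set [com_upto] does not depend on the value at p, so
   forgetting that value leaves at most n0 preimages of each bad tuple. *)
Lemma good_point (Q : finType) (Y : {set T}) (Om : {set {ffun Q -> T}}) (c n0 w0 kap : nat) :
  0 < c ->
  (forall W : {set T}, w0 <= #|W| -> #|bad_vertices e c W| <= n0) ->
  (forall p, #|forget p @: Om| <= kap) ->
  2 ^ #|Q| * #|Q| * (n0 * kap) < #|Om| ->
  exists2 x, x \in Om &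
    forall I, c ^ #|Q| * w0 <= #|com Y x I| -> #|com Y x I| <= c ^ #|Q| * #|exact Y x I|.
Proof.
move=> c0 badW proj big.
(* The tuple is bad at [(I, p)] when imposing non-adjacency to [x p] shrinks the current set by more
   than a factor [c]. *)
pose bad (ip : {set Q} * Q) := [set x in Om | [&& ip.2 \notin ip.1,
  w0 <= #|com_upto Y ip.1 (enum_rank ip.2) x| &
  x ip.2 \in bad_vertices e c (com_upto Y ip.1 (enum_rank ip.2) x)]].
have badle ip : #|bad ip| <= n0 * kap.
  case: ip => I p; apply: leq_trans (_ : n0 * #|forget p @: bad (I, p)| <= _); last first.
    rewrite leq_mul2l; apply/orP; right; apply: leq_trans (proj p).
    by apply/subset_leq_card/imsetS/subsetP => x; rewrite inE => /andP[].
  apply: card_fiber_le => z.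
  case: (set_0Vmem [set x in bad (I, p) | forget p x == z]) => [->|[x0]]; first by rewrite cards0.
  rewrite inE => /andP[]; rewrite inE /= => /and4P[_ pI w0W _] /eqP fz.
  apply: leq_trans (badW _ w0W); rewrite -(@card_in_imset _ _ (fun x : {ffun Q -> T} => x p)).
    apply/subset_leq_card/subsetP => t /imsetP[x]; rewrite inE => /andP[].
    rewrite inE /= => /and4P[_ _ _ xb] /eqP fx ->.
    by rewrite (com_upto_forget _ (x' := x)) // fz fx.
  move=> x x'; rewrite !inE => /andP[_ /eqP fx] /andP[_ /eqP fx'] xx'.
  apply/ffunP => q; have [->|qp] := eqVneq q p; first exact: xx'.
  by apply: (forgetE (p := p)) => //; rewrite fx fx'.
(* There are [2 ^ #|Q| * #|Q|] pairs [(I, p)], so the lower bound on [#|Om|] is what the union bound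
   asks for. *)
have [x xOm nbad] : exists2 x, x \in Om & forall ip, x \notin bad ip.
  have : ~~ (Om \subset \bigcup_(ip : {set Q} * Q) bad ip).
    apply: contraTN big => /subset_leq_card le; rewrite -leqNgt (leq_trans le) //.
    apply: leq_trans (card_bigcup_le _ _) _.
    apply: (@leq_trans (\sum_(ip : {set Q} * Q) n0 * kap)); first exact: leq_sum.
    by rewrite sum_nat_const card_prod -[#|{set Q}|]cardsT -powersetT card_powerset cardsT.
  case/subsetPn => x xOm nU; exists x => // ip; apply: contra nU => xb.
  by apply/bigcupP; exists ip.
exists x => // I big_I.
have step r : r <= #|Q| -> #|com Y x I| <= c ^ r * #|com_upto Y I r x|.
  elim: r => [_|r IH rQ].
    rewrite expn0 mul1n; apply/subset_leq_card/subsetP => y yc; rewrite in_set yc /=.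
    by apply/forallP => p; rewrite ltn0 andbF.
  have IH' := IH (ltnW rQ).
  pose p := enum_val (Ordinal rQ); have rp : enum_rank p = r :> nat by rewrite enum_valK.
  apply: (leq_trans IH'); rewrite expnSr -mulnA leq_mul2l; apply/orP; right.
  have [pI|pI] := boolP (p \in I).
    apply: (@leq_trans #|com_upto Y I r.+1 x|); last by rewrite leq_pmull.
    apply/subset_leq_card/subsetP => y; rewrite !inE => /andP[-> /forallP h] /=.
    apply/forallP => q; apply/implyP => /andP[qI]; rewrite ltnS leq_eqVlt => /orP[/eqP qr|qr].
      have qp : q = p by apply: enum_rank_inj; apply: val_inj; rewrite /= qr rp.
      by rewrite -qp (negPf qI) in pI.
    by apply: (implyP (h q)); rewrite qI.
  (* After [r] steps at most a factor [c ^ r] is lost from [c ^ #|Q| * w0], so the current set still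
     has at least [w0] elements. *)
  have w0W : w0 <= #|com_upto Y I (enum_rank p) x|.
    rewrite rp; have cr : c ^ r * w0 <= c ^ r * #|com_upto Y I r x|.
      apply: leq_trans IH'; apply: leq_trans big_I; rewrite leq_mul2r; apply/orP; right.
      by rewrite leq_pexp2l // ltnW.
    by rewrite leq_pmul2l ?expn_gt0 ?c0 // in cr.
  have := nbad (I, p); rewrite inE xOm /= pI w0W /= inE -leqNgt rp => le.
  apply: leq_trans le _; rewrite leq_mul2l; apply/orP; right.
  apply/subset_leq_card/subsetP => y; rewrite in_nonbh => /andP[+ nxy].
  rewrite !inE => /andP[-> /forallP h] /=.
  apply/forallP => q; apply/implyP => /andP[qI]; rewrite ltnS leq_eqVlt => /orP[/eqP qr|qr].
    have -> : q = p by apply: enum_rank_inj; apply: val_inj; rewrite /= qr rp.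
    by rewrite e_sym.
  by apply: (implyP (h q)); rewrite qI.
apply: leq_trans (step _ (leqnn _)) _; rewrite leq_mul2l; apply/orP; right.
apply/subset_leq_card/subsetP => y; rewrite !inE => /andP[/andP[-> /forallP h1] /forallP h2] /=.
apply/forallP => p; have [pI|pI] := boolP (p \in I).
  by have := h1 p; rewrite pI /= => ->.
by have := h2 p; rewrite pI ltn_ord /= => /negPf ->.
Qed.
(** Greedy choice: the bad vertices of all remaining sets number less than [w1], so the first set
    contains some [a] bad for none of them. Each remaining set is cut down to the non-neighbours of
    [a], losing at most a factor [c]. The vertex [t0] is a default value outside [js]. *)
Lemma independent_transversal (J : finType) (t0 : T) (c n0 w1 : nat) (js : seq J)
    (C : J -> {set T}) : 0 < c -> uniq js ->
  (forall W : {set T}, w1 <= #|W| -> #|bad_vertices e c W| <= n0) ->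
  size js * n0 < w1 -> {in js, forall j, c ^ size js * w1 <= #|C j|} ->
  exists2 g : J -> T, {in js, forall j, g j \in C j} &
    {in js &, forall j j', j != j' -> ~~ e (g j) (g j')}.
Proof.
move=> c0 + badW; elim: js C => [|j js IH] C /=; first by exists (fun=> t0).
move=> /andP[jjs ujs] lt bigC.
have [a aC aok] : exists2 a, a \in C j & {in js, forall i, a \notin bad_vertices e c (C i)}.
  have : ~~ (C j \subset \bigcup_(i in js) bad_vertices e c (C i)).
    apply: contraTN lt => /subset_leq_card le; rewrite -leqNgt.
    have := bigC j (mem_head _ _) => bj.
    apply: leq_trans (_ : #|C j| <= _); first by apply: leq_trans bj; rewrite leq_pmull // expn_gt0 c0.
    apply: leq_trans le _; apply: leq_trans (card_bigcup_le _ _) _.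
    apply: (@leq_trans (\sum_(i in js) n0)).
      apply: leq_sum => i ijs; apply: badW; apply: leq_trans (bigC i _).
        by rewrite leq_pmull // expn_gt0 c0.
      by rewrite inE ijs orbT.
    rewrite sum_nat_const leq_mul2r; apply/orP; right.
    by apply: leq_trans (card_size _) _; exact: leqnSn.
  case/subsetPn => a aC nU; exists a => // i ijs; apply: contra nU => ab.
  by apply/bigcupP; exists i.
have [||g gC gind] := IH (fun i => C i :\: nbh (C i) a) ujs.
- by apply: leq_ltn_trans lt; rewrite leq_mul2r leqnSn orbT.
- move=> i ijs; have := aok i ijs; rewrite inE -leqNgt => le.
  have ij : i \in j :: js by rewrite inE ijs orbT.
  have := leq_trans (bigC i ij) le; rewrite expnS -mulnA leq_pmul2l //.
have gN i : i \in js -> ~~ e a (g i).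
  by move=> ijs; have := gC i ijs; rewrite in_nonbh => /andP[].
exists (fun i => if i == j then a else g i) => [i|i i'].
  rewrite inE; case: eqP => [-> //|_] /= ijs.
  by have := gC i ijs; rewrite in_nonbh => /andP[].
rewrite !inE; case: eqVneq => [->|nij] /=; case: eqVneq => [->|ni'j] //=.
- by move=> _ i'js _; apply: gN.
- by move=> ijs _ _; rewrite e_sym; apply: gN.
- by move=> ijs i'js; apply: gind.
Qed.

(** The [x p] are the points, and an independent transversal of the sets [exact Y x I] provides the
    lines. By exactness the line vertex of [I] sees precisely the image of [I], so linearity of [LL]
    becomes the codegree condition of [bip_good]. *)
Lemma linear_embedding (k : nat) (Q : finType) (Y : {set T}) (x : {ffun Q -> T})
    (LL : {set {set Q}}) (c n0 w1 : nat) :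
  0 < k -> 0 < c -> injective x -> (forall p p', ~~ e (x p) (x p')) ->
  (forall W : {set T}, w1 <= #|W| -> #|bad_vertices e c W| <= n0) ->
  #|LL| * n0 < w1 -> 0 < #|LL| -> #|Q| <= #|LL| ->
  {in LL, forall I : {set Q}, k <= #|I|} ->
  {in LL &, forall I I' : {set Q}, I != I' -> #|I :&: I'| <= 1} ->
  {in LL, forall I, c ^ #|LL| * w1 <= #|exact Y x I|} ->
  has_good e k.
Proof.
move=> k0 c0 xinj xind badW lt LL0 QLL kLL lin big.
have [I0 I0L] := card_gt0P LL0.
have [p0 _] := card_gt0P (leq_trans k0 (kLL _ I0L)).
have [||||g gE gind] := @independent_transversal _ (x p0) c n0 w1 (enum LL) (exact Y x) c0.
- exact: enum_uniq.
- exact: badW.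
- by rewrite -cardE.
- by move=> I; rewrite mem_enum -cardE; apply: big.
have gI I p : I \in LL -> e (g I) (x p) = (p \in I).
  move=> IL; have := gE I; rewrite mem_enum => /(_ IL); rewrite inE => /andP[_ /forallP /(_ p)].
  by move/eqP.
have ginj : {in LL &, injective g}.
  by move=> I I' IL I'L E; apply/setP => p; rewrite -!gI // E.
pose X := x @: [set: Q].
have nbX I : I \in LL -> nbh X (g I) = x @: I.
  move=> IL; apply/setP => v; rewrite inE; apply/andP/imsetP.
    by case=> /imsetP[p _ ->]; rewrite gI //; exists p.
  by case=> p pI ->; rewrite gI //; split=> //; apply: imset_f.
apply: (@bip_good _ e e_sym k X (g @: LL)) => //.
- by apply/set0Pn; exists (g I0); apply: imset_f.
- by move=> _ _ /imsetP[p _ ->] /imsetP[p' _ ->].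
- move=> _ _ /imsetP[I IL ->] /imsetP[I' I'L ->].
  have [->|nII] := eqVneq I I'; first by rewrite e_irr.
  by apply: gind; rewrite ?mem_enum.
- by move=> _ /imsetP[I IL ->]; rewrite nbX // card_imset // kLL.
- move=> _ _ /imsetP[I IL ->] /imsetP[I' I'L ->] ngg.
  rewrite !nbX // -imsetI; last by move=> ? ? _ _; apply: xinj.
  by rewrite card_imset // lin //; apply: contraNneq ngg => ->.
- by rewrite (card_in_imset ginj) /X card_imset // cardsT.
Qed.
End Embedding.

(** * Linear designs *)

(** The points form a grid with [k] columns, labelled by distinct elements of [F], and rows indexed
    by [F]; lines are the graphs of affine functions over these columns. Distinct affine functions
    agree at most once. The cell [(i, y)] is coded as [i * #|F| + enum_rank y]. *)
Lemma linear_design_field (F : finFieldType) (k n : nat) : 1 < k -> k <= #|F| -> k * #|F| <= n ->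
  exists LL : {set {set 'I_n}}, [/\ #|LL| = #|F| ^ 2,
    {in LL, forall I : {set 'I_n}, #|I| = k} &
    {in LL &, forall I I' : {set 'I_n}, I != I' -> #|I :&: I'| <= 1}].
Proof.
move=> k1 kF kFn.
have ltn (i : 'I_k) (y : F) : i * #|F| + enum_rank y < n.
  apply: leq_trans kFn; apply: (@leq_trans (i.+1 * #|F|)); last by rewrite leq_mul2r ltn_ord orbT.
  by rewrite mulSn addnC ltn_add2r ltn_ord.
pose pt i y := Ordinal (ltn i y).
have ptinj i y i' y' : pt i y = pt i' y' -> i = i' /\ y = y'.
  move/(congr1 val) => /= E.
  have F0 : 0 < #|F| by apply: leq_trans kF; exact: ltnW.
  have ii : i = i' :> nat.
    move: (congr1 (divn^~ #|F|) E).
    by rewrite !divnMDl // !divn_small ?ltn_ord // !addn0.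
  split; first exact: val_inj.
  by apply/enum_rank_inj/val_inj => /=; move: E; rewrite ii => /addnI.
pose iota (i : 'I_k) : F := enum_val (widen_ord kF i).
have iota_inj : injective iota by move=> i i' /enum_val_inj /(congr1 val) /= /val_inj.
pose line (mc : F * F) := [set pt i (mc.1 * iota i + mc.2)%R | i : 'I_k].
have two mc mc' i i' : i != i' -> (mc.1 * iota i + mc.2 = mc'.1 * iota i + mc'.2)%R ->
    (mc.1 * iota i' + mc.2 = mc'.1 * iota i' + mc'.2)%R -> mc = mc'.
  case: mc mc' => [m c] [m' c'] /= nii E E'.
  have mm : ((m - m') * (iota i - iota i') = 0)%R.
    rewrite GRing.mulrBl !GRing.mulrBr; apply/eqP; rewrite GRing.subr_eq0; apply/eqP.
    have -> : (m * iota i - m * iota i' = (m * iota i + c) - (m * iota i' + c))%R.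
      by rewrite GRing.opprD GRing.addrACA GRing.subrr GRing.addr0.
    by rewrite E E' GRing.opprD GRing.addrACA GRing.subrr GRing.addr0.
  move/eqP: mm; rewrite GRing.mulf_eq0 !GRing.subr_eq0 => /orP[/eqP mm|/eqP /iota_inj ii].
    by subst m'; move/GRing.addrI: E => ->.
  by rewrite ii eqxx in nii.
have cline mc : #|line mc| = k.
  by rewrite card_imset ?cardsT ?card_ord // => i i' /ptinj[].
have lin mc mc' : mc != mc' -> #|line mc :&: line mc'| <= 1.
  move=> nmc; rewrite leqNgt; apply/negP => /card_gt1P[u [v [/setIP[uL uL'] /setIP[vL vL'] nuv]]].
  case/imsetP: uL => i _ ui; case/imsetP: vL => i' _ vi'.
  case/imsetP: uL' => j _; rewrite ui => /ptinj[<- Ei].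
  case/imsetP: vL' => j' _; rewrite vi' => /ptinj[<- Ei'].
  have nii : i != i' by apply: contraNneq nuv => ii; rewrite ui vi' ii.
  by rewrite (two mc mc' i i' nii Ei Ei') eqxx in nmc.
(* Here [1 < k] enters: equal lines share [k] points, lines with distinct parameters at most one. *)
have linj : injective line.
  move=> mc mc' E; apply/eqP/negPn/negP => /lin; rewrite E setIid cline.
  by rewrite leqNgt k1.
exists (line @: [set: F * F]); split.
- by rewrite card_imset // cardsT card_prod.
- by move=> _ /imsetP[mc _ ->].
- move=> _ _ /imsetP[mc _ ->] /imsetP[mc' _ ->] nl; apply: lin.
  by apply: contraNneq nl => ->.
Qed.

(** Uses the field whose order is the least power of two that is at least [m]. Since [q] is chosen
    before [n], the number of points can be fixed later. *)
Lemma linear_design (k m : nat) : 1 < k -> k <= m -> exists q : nat, [/\ m <= q, q <= 2 * m &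
  forall n, k * q <= n -> exists LL : {set {set 'I_n}}, [/\ #|LL| = q ^ 2,
    {in LL, forall I : {set 'I_n}, #|I| = k} &
    {in LL &, forall I I' : {set 'I_n}, I != I' -> #|I :&: I'| <= 1}]].
Proof.
move=> k1 km; pose r := up_log 2 m.
have r0 : 0 < r by rewrite up_log_gt0; lia.
have [F _ cF] := @PrimePowerField 2 r isT r0.
have mq : m <= 2 ^ r by apply: up_logP.
exists #|F|; rewrite cF; split=> //.
  have := @up_log_gtn 2 m isT; rewrite -/r => lt; have {lt} : 2 ^ r.-1 < m by apply: lt; lia.
  by rewrite -[in 2 ^ r](prednK r0) expnS; lia.
move=> n; rewrite -cF; apply: linear_design_field => //; rewrite cF; lia.
Qed.

(** * Dense pairs *)

Definition tuples_in (J T : finType) (A : {set T}) : {set {ffun J -> T}} :=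
  [set x : {ffun J -> T} | [forall j, x j \in A]].

Lemma card_tuples_in (J T : finType) (A : {set T}) : #|tuples_in J A| = #|A| ^ #|J|.
Proof.
rewrite -card_ffun_on; apply: eq_card => x; rewrite inE.
by apply/forallP/ffun_onP.
Qed.

Section Dense.
Variables (T : finType) (e : rel T).
Hypothesis (e_sym : symmetric e) (e_irr : irreflexive e).
Notation nbh := (nbh e).
Notation com := (com e).
Notation exact := (exact e).

Definition ind_tuples (n : nat) (C : {set T}) : {set {ffun 'I_n -> T}} :=
  [set x in tuples_in 'I_n C |
    [forall i, forall j, (i != j) ==> (x i != x j) && ~~ e (x i) (x j)]].

Lemma ind_tuplesP n (C : {set T}) (x : {ffun 'I_n -> T}) :
  reflect ((forall i, x i \in C) /\
           (forall i j, i != j -> x i != x j /\ ~~ e (x i) (x j)))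
          (x \in ind_tuples n C).
Proof.
rewrite !inE; apply: (iffP andP) => [[/forallP h1 /forallP h2]|[h1 h2]]; split=> //.
- by move=> i j nij; have := implyP (forallP (h2 i) j) nij => /andP[].
- exact/forallP.
- by do 2!apply/forallP => ?; apply/implyP => /h2[-> ->].
Qed.

Lemma card_ind_tuplesS n (C : {set T}) :
  \sum_(a in C) #|ind_tuples n (C :\: nbh C a :\ a)| <= #|ind_tuples n.+1 C|.
Proof.
rewrite -[X in _ <= X]sum1_card.
rewrite (partition_big (fun x : {ffun 'I_n.+1 -> T} => x ord0) (mem C)) /=; last first.
  by move=> x /ind_tuplesP[h _].
apply: leq_sum => a aC; rewrite sum1dep_card.
pose cons (x : {ffun 'I_n -> T}) := [ffun i => oapp x a (unlift ord0 i)].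
rewrite -(@card_imset _ _ cons); last first.
  move=> x x' /ffunP E; apply/ffunP => i.
  by move: (E (lift ord0 i)); rewrite !ffunE liftK.
apply/subset_leq_card/subsetP => _ /imsetP[x /ind_tuplesP[xC xi] ->].
have xa i : [/\ x i \in C, x i != a & ~~ e a (x i)].
  by have := xC i; rewrite in_setD1 in_nonbh => /and3P[-> -> ->].
rewrite inE ffunE unlift_none /= eqxx andbT; apply/ind_tuplesP; split=> [i|i j].
  by rewrite ffunE; case: unliftP => [i' _|_] //=; have [] := xa i'.
rewrite !ffunE; case: unliftP => [i' ->|->]; case: unliftP => [j' ->|->] //=.
- by rewrite (inj_eq lift_inj) => /xi.
- by move=> _; have [_ -> h] := xa i'; rewrite e_sym.
- by move=> _; have [_ h ->] := xa j'; rewrite eq_sym.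
Qed.

(** Entries are chosen one by one. By [kss_bad] at least half of [C] is not bad, and for such an [a]
    deleting its neighbours and [a] itself leaves at least [#|C| / (4 * s)] vertices. These losses
    accumulate, whence the exponent [n ^ 2]. *)
Lemma card_ind_tuples_ge (s n : nat) (C : {set T}) : 0 < s -> ~ has_Kss e s ->
  (8 * s) ^ n <= #|C| -> #|C| ^ n <= (8 * s) ^ (n ^ 2) * #|ind_tuples n C|.
Proof.
move=> s0 nK; elim: n C => [|n IH] C big.
  rewrite !expn0 mul1n card_gt0; apply/set0Pn; exists [ffun i : 'I_0 => False_rect T (notF (ltn_ord i))].
  by apply/ind_tuplesP; split=> -[].
have C8 : 8 * s <= #|C| by apply: leq_trans big; rewrite expnS leq_pmulr // expn_gt0 muln_gt0 s0.
have badlt : #|bad_vertices e (2 * s) C| < s by apply: kss_bad => //; lia.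
have C2 : #|C| <= 2 * #|C :\: bad_vertices e (2 * s) C|.
  have := subset_leq_card (subsetIr C (bad_vertices e (2 * s) C)); rewrite cardsD; lia.
have term a : a \in C :\: bad_vertices e (2 * s) C ->
    #|C| ^ n <= (4 * s) ^ n * (8 * s) ^ (n ^ 2) * #|ind_tuples n (C :\: nbh C a :\ a)|.
  rewrite !inE -leqNgt => /andP[gooda aC].
  set C' := C :\: nbh C a :\ a.
  have C'4 : #|C| <= 4 * s * #|C'|.
    have := cardsD1 a (C :\: nbh C a); rewrite -/C'; case: (_ \in _) => /= E; rewrite E in gooda; nia.
  have big' : (8 * s) ^ n <= #|C'|.
    by rewrite -(@leq_pmul2l (8 * s)) ?muln_gt0 // -expnS; nia.
  rewrite -mulnA; apply: leq_trans (_ : (4 * s * #|C'|) ^ n <= _); first by rewrite leq_exp2rw.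
  by rewrite expnMn leq_mul2l IH ?orbT.
have sum_ge : #|C :\: bad_vertices e (2 * s) C| * #|C| ^ n <=
    (4 * s) ^ n * (8 * s) ^ (n ^ 2) * #|ind_tuples n.+1 C|.
  rewrite -sum_nat_const; apply: leq_trans (leq_sum _ term) _.
  rewrite -big_distrr leq_mul2l; apply/orP; right; apply: leq_trans (card_ind_tuplesS _ _).
  rewrite [X in _ <= X](bigID (mem (bad_vertices e (2 * s) C))) /=.
  apply: leq_trans (leq_addl _ _); rewrite leq_eqVlt; apply/orP; left; apply/eqP.
  by apply: eq_bigl => a; rewrite !inE andbC.
have E2 : 2 * ((4 * s) ^ n * (8 * s) ^ (n ^ 2)) <= (8 * s) ^ (n.+1 ^ 2).
  have -> : n.+1 ^ 2 = 1 + n + n + n ^ 2 by rewrite -!mulnn; lia.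
  rewrite !expnD mulnA leq_mul2r; apply/orP; right; rewrite expn1.
  apply: leq_trans (_ : 2 * (8 * s) ^ n <= _).
    by rewrite leq_mul2l /= leq_exp2rw // leq_mul2r orbT.
  rewrite -mulnA leq_mul //; first by lia.
  by rewrite leq_pmull // expn_gt0 muln_gt0 s0.
rewrite expnS; apply: leq_trans (_ : 2 * (#|C :\: bad_vertices e (2 * s) C| * #|C| ^ n) <= _).
  by rewrite mulnA leq_mul2r C2 orbT.
apply: leq_trans (_ : 2 * ((4 * s) ^ n * (8 * s) ^ (n ^ 2) * #|ind_tuples n.+1 C|) <= _).
  by rewrite leq_mul2l sum_ge.
by rewrite mulnA leq_mul2r E2 orbT.
Qed.

(** For [good_point], tuples must far outnumber tuples with one entry deleted. If all ratios between
    lengths [h] and [2 * h] were at most [K], there would be at most [K ^ h * #|C| ^ h] independent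
    tuples of length [2 * h], against [card_ind_tuples_ge]. *)
Lemma ind_tuples_ratio (s h K : nat) (C : {set T}) : 0 < s -> 0 < h -> 0 < K ->
  ~ has_Kss e s -> K * (8 * s) ^ (4 * h) < #|C| ->
  exists n, [/\ h <= n, n < 2 * h & K * #|ind_tuples n C| < #|ind_tuples n.+1 C|].
Proof.
move=> s0 h0 K0 nK big.
have big2 : (8 * s) ^ (2 * h) <= #|C|.
  apply: leq_trans (ltnW big); apply: leq_trans (_ : (8 * s) ^ (4 * h) <= _).
    by rewrite leq_pexp2l ?muln_gt0 // leq_mul2r orbT.
  by rewrite leq_pmull.
have lower := card_ind_tuples_ge s0 nK big2.
case: (pickP [pred j : 'I_h | K * #|ind_tuples (h + j) C| < #|ind_tuples (h + j).+1 C|]) => [j|none].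
  by move=> /= lt; exists (h + j); split=> //; rewrite ?leq_addr //; have := ltn_ord j; lia.
have upper j : j <= h -> #|ind_tuples (h + j) C| <= K ^ j * #|ind_tuples h C|.
  elim: j => [|j IH jh]; first by rewrite addn0 mul1n.
  have := none (Ordinal jh); rewrite /= ltnNge => /negbFE le.
  rewrite addnS; apply: leq_trans le _; rewrite expnS -mulnA leq_mul2l IH ?orbT //.
  exact: ltnW.
have base : #|ind_tuples h C| <= #|C| ^ h.
  rewrite -[X in _ ^ X]card_ord -card_tuples_in; apply/subset_leq_card/subsetP => x.
  by rewrite inE => /andP[].
have C0 : 0 < #|C| by apply: leq_trans big; rewrite ltnS.
have : #|C| ^ h * #|C| ^ h <= ((8 * s) ^ (4 * h) * K) ^ h * #|C| ^ h.
  rewrite -expnD addnn -mul2n; apply: leq_trans lower _.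
  have -> : (2 * h) ^ 2 = 4 * h * h by rewrite -mulnn; lia.
  rewrite [(_ * K) ^ h]expnMn -expnM -[X in _ <= X]mulnA leq_mul2l; apply/orP; right.
  have := upper h (leqnn _); rewrite addnn -mul2n => le; apply: leq_trans le _.
  by rewrite leq_mul2l base orbT.
rewrite leq_pmul2r ?expn_gt0 ?C0 // leq_exp2r // mulnC leqNgt big //.
Qed.

Lemma card_forget_ind_tuples n (C : {set T}) (p : 'I_n.+1) :
  #|[set forget p x | x in ind_tuples n.+1 C]| <= #|ind_tuples n C|.
Proof.
pose del (x : {ffun 'I_n.+1 -> T}) := [ffun i => x (lift p i)].
pose G (y : {ffun 'I_n -> T}) := [ffun q => omap y (unlift p q)].
have E : [set forget p x | x in ind_tuples n.+1 C] = G @: (del @: ind_tuples n.+1 C).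
  rewrite -imset_comp; apply: eq_imset => x /=; apply/ffunP => q; rewrite !ffunE.
  case: unliftP => [q' ->|->] /=; last by rewrite eqxx.
  by rewrite eq_sym (negPf (neq_lift _ _)) ffunE.
rewrite E; apply: leq_trans (leq_imset_card _ _) _.
apply/subset_leq_card/subsetP => _ /imsetP[x /ind_tuplesP[h1 h2] ->].
apply/ind_tuplesP; split=> [i|i j nij]; rewrite !ffunE //.
by apply: h2; rewrite (inj_eq lift_inj).
Qed.

(* Dependent random choice: X' is obtained from the common neighbourhood in X of 2k random
   vertices of Y. *)
Lemma rich_subset (X Y : {set T}) (k E M : nat) : 0 < k -> 2 * E ^ (2 * k) <= M ^ 2 ->
  #|X| = M ^ 2 -> M ^ 2 <= #|Y| -> {in X, forall x, #|Y| <= E * #|nbh Y x|} ->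
  exists X' : {set T}, [/\ X' \subset X, M ^ 2 <= 2 * E ^ (2 * k) * #|X'| &
    forall w : {ffun 'I_k -> T}, w \in tuples_in _ X' -> M <= #|com Y w [set: 'I_k]|].
Proof.
move=> k0 EN cX NY dens; set t := 2 * k.
have [N NE] : exists N, N = M ^ 2 by exists (M ^ 2).
rewrite -NE in EN cX NY *.
have [N0|N0] := posnP N.
  exists set0; split; rewrite ?sub0set ?N0 // => w.
  have M0 : M = 0 by move: N0; rewrite NE; case: (M) => // m; rewrite -mulnn.
  by rewrite M0.
pose cn (y : {ffun 'I_t -> T}) := [set x in X | [forall i, e x (y i)]].
pose poor := [set w in tuples_in 'I_k X | #|com Y w [set: 'I_k]| < M].
pose poor_in (y : {ffun 'I_t -> T}) := [set w in poor | [forall j, w j \in cn y]].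
have cY : #|tuples_in 'I_t Y| = #|Y| ^ t by rewrite card_tuples_in card_ord.
have S1 : N * #|Y| ^ t <= E ^ t * \sum_(y in tuples_in 'I_t Y) #|cn y|.
  rewrite (sum_card_swap (mem (tuples_in 'I_t Y)) (mem X) (fun y x => [forall i, e x (y i)])) /=.
  rewrite -cX -sum_nat_const big_distrr; apply: leq_sum => x xX.
  have -> : #|[set y in tuples_in 'I_t Y | [forall i, e x (y i)]]| = #|nbh Y x| ^ t.
    rewrite -[t in RHS]card_ord -card_tuples_in; apply: eq_card => y; rewrite !inE.
    apply/andP/forallP => [[/forallP h1 /forallP h2] i|h]; first by rewrite inE h1 h2.
    by split; apply/forallP => i; have := h i; rewrite inE => /andP[].
  by rewrite /= -expnMn leq_exp2rw // dens.
(* A poor [w] has fewer than [M] common neighbours, so at most [M ^ t] choices of [y] have [w]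
   inside [cn y]. *)
have S2 : \sum_(y in tuples_in 'I_t Y) #|poor_in y| <= N ^ k * M ^ t.
  rewrite (sum_card_swap (mem (tuples_in 'I_t Y)) (mem poor) (fun y w => [forall j, w j \in cn y])) /=.
  apply: leq_trans (_ : \sum_(w in poor) M ^ t <= _); last first.
    rewrite sum_nat_const leq_mul2r; apply/orP; right; rewrite -cX -[k in X in _ <= X]card_ord.
    by rewrite -card_tuples_in; apply/subset_leq_card/subsetP => w; rewrite inE => /andP[].
  apply: leq_sum => w; rewrite inE => /andP[_ /ltnW le].
  apply: leq_trans (leq_exp2rw t le); rewrite -[t in X in _ <= X]card_ord -card_tuples_in.
  apply/subset_leq_card/subsetP => y; rewrite !inE => /andP[/forallP yY /forallP h].
  apply/forallP => i; rewrite inE yY /=; apply/forallP => j; rewrite inE /=.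
  by have := h j; rewrite inE e_sym => /andP[_ /forallP].
(* The summand 1 makes the averaged inequality strict. *)
have [y yY lty] : exists2 y, y \in tuples_in 'I_t Y &
    2 * E ^ t * #|poor_in y| + N < 2 * E ^ t * #|cn y| + 1.
  apply: sum_lt_exists; rewrite !big_split /= -!big_distrr /= !sum_nat_const cY.
  (* Since [t = 2 * k] and [N = M ^ 2], the left side is [N ^ t]: on average there is at most one
     poor tuple per [y]. *)
  have E3 : N ^ k * M ^ t <= #|Y| ^ t.
    by rewrite NE /t -expnM -expnD addnn -mul2n expnM -NE leq_exp2rw.
  have Yt : 0 < #|Y| ^ t by rewrite expn_gt0 (leq_trans N0 NY).
  have E4 : 2 * E ^ t * #|Y| ^ t <= N * #|Y| ^ t by rewrite leq_mul2r EN orbT.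
  have E5 : 2 * E ^ t * \sum_(y in tuples_in 'I_t Y) #|poor_in y| <= 2 * E ^ t * #|Y| ^ t.
    by rewrite leq_mul2l (leq_trans S2 E3) orbT.
  move: S1 E4 E5 Yt; move: (\sum_(y in _) #|cn y|) (\sum_(y in _) #|poor_in y|) => c p.
  move: (E ^ t) (#|Y| ^ t) => a b S1 E4 E5 Yt.
  have {}S1 : 2 * (N * b) <= 2 * a * c by rewrite -mulnA leq_mul2l.
  have {E4}E5 : 2 * a * p <= N * b by apply: leq_trans E5 _.
  rewrite muln1 [b * N]mulnC; lia.
(* Deleting the first entry of each poor tuple destroys them all, at one vertex per tuple. *)
pose X' := cn y :\: [set (w : {ffun 'I_k -> T}) (Ordinal k0) | w in poor_in y].
exists X'; split.
- by apply/subsetP => x; rewrite !inE => /andP[_ /andP[]].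
- have le1 : #|cn y| <= #|X'| + #|poor_in y|.
    rewrite /X'; set Z := [set _ | w in _].
    have : #|Z| <= #|poor_in y| by apply: leq_imset_card.
    have := subset_leq_card (subsetIr (cn y) Z); rewrite cardsD; lia.
  nia.
move=> w; rewrite inE => /forallP wX'; rewrite leqNgt; apply/negP => wpoor.
have wcn j : w j \in cn y by have := wX' j; rewrite in_setD => /andP[].
have := wX' (Ordinal k0); rewrite in_setD => /andP[/negP + _]; apply; apply: imset_f.
rewrite inE; apply/andP; split; last exact/forallP.
rewrite inE wpoor andbT inE; apply/forallP => j.
by have := wcn j; rewrite inE => /andP[].
Qed.
End Dense.

Lemma com_image (T : finType) (e : rel T) (Q J : finType) (Y : {set T}) (x : {ffun Q -> T})
    (sg : J -> Q) (I : {set Q}) :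
  [set sg j | j : J] = I -> com e Y x I = com e Y [ffun j => x (sg j)] [set: J].
Proof.
move=> <-; apply/setP => y; rewrite !inE; congr (_ && _).
apply/forallP/forallP => h j.
  by rewrite inE ffunE; have := h (sg j); rewrite imset_f.
apply/implyP => /imsetP[i _ ->]; by have := h i; rewrite inE ffunE.
Qed.

Lemma enum_image (Q : finType) (I : {set Q}) (k : nat) : #|I| = k ->
  exists sg : 'I_k -> Q, [set sg j | j : 'I_k] = I.
Proof.
move=> <-; exists (fun j => enum_val j); apply/setP => q; apply/imsetP/idP.
  by case=> j _ ->; exact: enum_valP.
by move=> qI; exists (enum_rank_in qI q); rewrite // enum_rankK_in.
Qed.

(* The exponent comes from a design with at most 8k^2 points and 16k^2 lines:
   each point and each line costs a factor 2s of a common neighbourhood. *)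
Lemma dense_good (k E : nat) : 1 < k -> exists s1 : nat, forall s, s1 <= s ->
  forall (T : finType) (e : rel T), symmetric e -> irreflexive e -> ~ has_Kss e s ->
  forall X Y : {set T}, s ^ (100 * k ^ 2) <= #|X| -> s ^ (100 * k ^ 2) <= #|Y| ->
  {in X, forall x, #|Y| <= E * #|nbh e Y x|} -> has_good e k.
Proof.
move=> k1; have k2k : k <= 2 * k by lia.
(* Order at least [2 * k]: the tuple used below has at most [2 * k * q] entries, hence no more
   points than the [q ^ 2] lines. *)
have [q [kq q4' design]] := linear_design k1 k2k.
have q4 : q <= 4 * k by lia.
clear k2k q4'.
(* Collects factors depending on [k] and [E] only, to be absorbed by a single factor [s]. *)
pose c0 := 2 * E ^ (2 * k) * (2 ^ (8 * k ^ 2) * (8 * k ^ 2)).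
exists (8 + 16 * k ^ 2 + 2 + c0) => s sbig T e e_sym e_irr nK X0 Y sX sY dens0.
have s8 : 8 <= s by lia.
have k2 : 0 < k ^ 2 by rewrite expn_gt0; lia.
have [X XX0 cX] := subset_of_card sX.
have dens : {in X, forall x, #|Y| <= E * #|nbh e Y x|} by move=> x /(subsetP XX0) /dens0.
pose M := s ^ (50 * k ^ 2).
have M2 : M ^ 2 = s ^ (100 * k ^ 2) by rewrite -expnM; congr (_ ^ _); lia.
have c0s : c0 <= s by lia.
have s_pow j : 0 < j -> s <= s ^ j by move=> j0; rewrite -[X in X <= _]expn1 leq_pexp2l //; lia.
have [X' [X'X bigX' rich]] : exists X' : {set T}, [/\ X' \subset X,
    M ^ 2 <= 2 * E ^ (2 * k) * #|X'| &
    forall w : {ffun 'I_k -> T}, w \in tuples_in _ X' -> M <= #|com e Y w [set: 'I_k]|].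
  apply: rich_subset; rewrite ?M2 //; first lia.
  apply: leq_trans (s_pow _ _); last by lia.
  apply: leq_trans c0s; rewrite leq_pmulr // muln_gt0 expn_gt0; lia.
pose h := k * q; pose K := 2 ^ (2 * h) * (2 * h) * s.
have h8 : 2 * h <= 8 * k ^ 2 by rewrite /h -mulnn; nia.
have bigK : K * (8 * s) ^ (4 * h) < #|X'|.
  have [E0|E0] := posnP (E ^ (2 * k)).
    by move: bigX'; rewrite E0 M2 mul0n leqNgt expn_gt0; lia.
  rewrite -(@ltn_pmul2l (2 * E ^ (2 * k))) ?muln_gt0 //; apply: leq_trans bigX'.
  have p1 : (8 * s) ^ (4 * h) <= s ^ (32 * k ^ 2).
    apply: leq_trans (_ : (s ^ 2) ^ (4 * h) <= _).
      by apply: leq_exp2rw; rewrite -mulnn leq_mul2r s8 orbT.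
    by rewrite -expnM leq_pexp2l //; lia.
  have p2 : 2 * E ^ (2 * k) * K <= s ^ 2.
    rewrite /K mulnA -mulnn leq_mul2r; apply/orP; right; apply: leq_trans c0s.
    rewrite /c0 leq_mul2l; apply/orP; right; apply: leq_mul => //.
    by rewrite leq_pexp2l.
  rewrite mulnA; apply: leq_ltn_trans (leq_mul p2 p1) _.
  by rewrite -expnD M2 ltn_exp2l; lia.
have [n [hn n2h ratio]] : exists n, [/\ h <= n, n < 2 * h &
    K * #|ind_tuples e n X'| < #|ind_tuples e n.+1 X'|].
  apply: (@ind_tuples_ratio _ e e_sym e_irr s) => //; rewrite /K /h ?muln_gt0 ?expn_gt0; lia.
have kqn : k * q <= n.+1 by rewrite /h in hn; lia.
have [LL [cLL kLL linLL]] := design n.+1 kqn.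
have badW (W : {set T}) : 2 * s <= #|W| -> #|bad_vertices e (2 * s) W| <= s.
  by move=> sW; apply/ltnW/kss_bad.
have [x /ind_tuplesP[xX' xind] xgood] : exists2 x, x \in ind_tuples e n.+1 X' &
    forall I, (2 * s) ^ #|'I_n.+1| * (2 * s) <= #|com e Y x I| ->
      #|com e Y x I| <= (2 * s) ^ #|'I_n.+1| * #|exact e Y x I|.
  apply: (@good_point _ e e_sym _ Y _ (2 * s) s (2 * s) #|ind_tuples e n X'|) => //; first lia.
    by move=> p; apply: card_forget_ind_tuples.
  rewrite card_ord; apply: leq_ltn_trans ratio; rewrite mulnA leq_mul2r; apply/orP; right.
  rewrite /K leq_mul2r; apply/orP; right; apply: leq_mul => //.
  by rewrite leq_pexp2l.
(* The total loss: [2 * s] for each of the [n.+1] points and [q ^ 2] lines, with a final size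
   exceeding the [q ^ 2 * s] vertices that may be bad for some line. *)
have Mbig : (2 * s) ^ n.+1 * ((2 * s) ^ (q ^ 2) * ((q ^ 2 + 2) * s)) <= M.
  rewrite mulnA -expnD; apply: leq_trans (_ : (s ^ 2) ^ (24 * k ^ 2) * s ^ 2 <= _).
    apply: leq_mul.
      apply: leq_trans (_ : (s ^ 2) ^ (n.+1 + q ^ 2) <= _).
        by apply: leq_exp2rw; rewrite -mulnn leq_mul2r; lia.
      apply: leq_pexp2l; first by rewrite expn_gt0; lia.
      have : q ^ 2 <= 16 * k ^ 2 by rewrite -!mulnn; nia.
      by lia.
    rewrite -[s ^ 2]mulnn leq_mul2r; apply/orP; right.
    have : q ^ 2 <= 16 * k ^ 2 by rewrite -!mulnn; nia.
    lia.
  by rewrite -expnM -expnD leq_pexp2l //; lia.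
apply: (@linear_embedding _ e e_sym e_irr k _ Y x LL (2 * s) s ((q ^ 2 + 2) * s)).
- exact: ltnW.
- by rewrite muln_gt0 (leq_trans _ s8).
- by move=> i j E1; apply/eqP/negPn/negP => /xind[]; rewrite E1 eqxx.
- move=> p p'; have [->|/xind[]//] := eqVneq p p'; by rewrite e_irr.
- by move=> W sW; apply: badW; apply: leq_trans sW; rewrite leq_mul2r; lia.
- by rewrite cLL ltn_mul2r (leq_trans _ s8) // addn2 ltnW.
- by rewrite cLL expn_gt0; move: kq k1; clear; lia.
- by rewrite card_ord cLL -mulnn; apply: leq_trans n2h _; rewrite /h mulnA leq_mul2r kq orbT.
- by move=> I /kLL ->.
- exact: linLL.
move=> I IL; have comI : M <= #|com e Y x I|.
  have [sg sgI] := enum_image (kLL _ IL).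
  rewrite (com_image _ _ _ sgI); apply: rich; rewrite inE; apply/forallP => j.
  by rewrite ffunE.
have xg := xgood I; rewrite card_ord in xg.
have p0 : 0 < (2 * s) ^ n.+1 by rewrite expn_gt0 muln_gt0 /=; move: s8; case: (s).
rewrite cLL -(leq_pmul2l p0); apply: (leq_trans Mbig); apply: (leq_trans comI); apply: xg.
apply: leq_trans comI; apply: leq_trans Mbig; rewrite leq_mul2l.
apply/orP; right; apply: leq_trans (_ : (q ^ 2 + 2) * s <= _).
  by rewrite leq_mul2r leq_addl orbT.
by rewrite leq_pmull // expn_gt0 muln_gt0 /=; move: s8; case: (s).
Qed.

(** * Almost regular graphs *)

(** For uniformly random [f] this contains each vertex independently with probability [1 / m.+1]. *)
Definition zeros (T : finType) (m : nat) (f : {ffun T -> 'I_m.+1}) : {set T} :=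
  [set x | f x == ord0].

(** The probability [(1 / m.+1) ^ #|X| * (m / m.+1) ^ #|F|] with denominators cleared; independence
    is the product formula for [family]. *)
Lemma card_sample (T : finType) (m : nat) (X F : {set T}) : [disjoint X & F] ->
  #|[set f : {ffun T -> 'I_m.+1} | (X \subset zeros f) && [disjoint F & zeros f]]|
    * m.+1 ^ (#|X| + #|F|) = m ^ #|F| * m.+1 ^ #|T|.
Proof.
move=> XF; pose G (x : T) : {pred 'I_m.+1} :=
  if x \in X then pred1 ord0 else if x \in F then predC1 ord0 else predT.
have -> : #|[set f : {ffun T -> 'I_m.+1} | (X \subset zeros f) && [disjoint F & zeros f]]|
    = #|family G|.
  apply: eq_card => f; rewrite inE; apply/andP/familyP.
    case=> /subsetP Xf Ff x; rewrite /G; case: ifP => [/Xf|_]; first by rewrite inE.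
    by case: ifP => // xF; have := disjointFr Ff xF; rewrite !inE => ->.
  move=> h; split.
    by apply/subsetP => x xX; have := h x; rewrite /G xX inE => /eqP fx; rewrite inE fx.
  rewrite disjoint_subset; apply/subsetP => x xF; have := h x.
  by rewrite /G (disjointFl XF xF) xF !inE.
rewrite card_family foldrE big_image /= expnD.
have pw (A : {set T}) (a : nat) : a ^ #|A| = \prod_(x : T) (if x \in A then a else 1).
  by rewrite -big_mkcond /= prod_nat_const.
have -> : m.+1 ^ #|T| = \prod_(x : T) m.+1 by rewrite prod_nat_const.
rewrite !pw -!big_split /=; apply: eq_bigr => x _; rewrite /G.
case: ifP => xX; first by rewrite (disjointFr XF xX) card1 !mul1n !muln1.
case: ifP => xF; first by rewrite cardC1 card_ord !mul1n.
by rewrite card_ord !muln1 mul1n.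
Qed.

Lemma sample_sum (T I : finType) (m j : nat) (R : {set I}) (supp : I -> {set T}) :
  {in R, forall i, #|supp i| = j} ->
  m.+1 ^ j * \sum_(f : {ffun T -> 'I_m.+1}) #|[set i in R | supp i \subset zeros f]|
    = #|R| * m.+1 ^ #|T|.
Proof.
move=> suppj; rewrite (sum_card_swap predT (mem R) (fun f i => supp i \subset zeros f)) /=.
rewrite big_distrr /= -sum_nat_const; apply: eq_bigr => i iR.
have := @card_sample T m (supp i) set0; rewrite disjoint_sym disjoints_subset sub0set => /(_ isT).
rewrite cards0 addn0 mul1n suppj // mulnC => <-; congr (_ * _); apply: eq_card => f.
by rewrite !inE disjoints_subset sub0set andbT.
Qed.

(** Bernoulli's inequality [(1 - 1 / m.+1) ^ j >= 1 - j / m.+1], whose right side is at least one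
    half. *)
Lemma bernoulli_half (m j : nat) : 2 * j <= m.+1 -> m.+1 ^ j <= 2 * m ^ j.
Proof.
move=> jm.
have bern i : i <= m.+1 -> (m.+1 - i) * m.+1 ^ i <= m.+1 * m ^ i.
  elim: i => [|i IH] im; first by rewrite subn0 !expn0.
  have {IH}IH := IH (ltnW im); rewrite !expnS.
  have E : (m.+1 - i.+1) * m.+1 <= m * (m.+1 - i) by nia.
  rewrite mulnA; apply: leq_trans (_ : m * (m.+1 - i) * m.+1 ^ i <= _).
    by rewrite leq_mul2r E orbT.
  by rewrite -mulnA [X in _ <= X]mulnCA leq_mul2l IH orbT.
have := bern j; have -> : j <= m.+1 by lia.
move=> /(_ isT) h; rewrite -(@leq_pmul2l m.+1) // mulnCA.
apply: leq_trans (_ : 2 * ((m.+1 - j) * m.+1 ^ j) <= _); last by rewrite leq_mul2l h.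
by rewrite mulnA leq_mul2r; apply/orP; right; lia.
Qed.

Definition no_dense_pair (T : finType) (e : rel T) (n E : nat) : Prop :=
  forall X Y : {set T}, n <= #|X| -> n <= #|Y| -> ~ {in X, forall x, #|Y| <= E * #|nbh e Y x|}.

Lemma card_set_seq (T : finType) (s : seq T) : uniq s -> #|[set x in s]| = size s.
Proof. by move=> us; rewrite cardsE; apply/card_uniqP. Qed.

Section Regular.
Variables (T : finType) (e : rel T).
Hypothesis (e_sym : symmetric e) (e_irr : irreflexive e).
Notation nbh := (nbh e).

Definition codeg (S : {set T}) (x c : T) : {set T} := nbh S x :&: nbh S c.

(** A 4-cycle [a b c d] is recorded by its diagonals [((a, c), (b, d))], once for every
    labelling. *)
Definition four_cycles (S : {set T}) : {set (T * T) * (T * T)} :=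
  [set z | [&& z.1.1 \in S, z.1.2 \in S, z.1.1 != z.1.2, z.2.1 != z.2.2,
    z.2.1 \in codeg S z.1.1 z.1.2 & z.2.2 \in codeg S z.1.1 z.1.2]].

Lemma sum_codeg (S : {set T}) x :
  \sum_(c in S) #|codeg S x c| = \sum_(b in nbh S x) #|nbh S b|.
Proof.
rewrite -[RHS](sum_nbh_swap e_sym S); apply: eq_bigr => c _.
by apply: eq_card => b; rewrite !inE; case: (b \in S); rewrite ?andbF.
Qed.

(* A vertex x has fewer than n partners c with codegree at least D/E, for these would form
   a dense pair with the neighbourhood of x. *)
Lemma card_four_cycles (S : {set T}) (n E L D : nat) : 0 < n -> n * E <= D ->
  no_dense_pair e n (L * E) -> {in S, forall v, #|nbh S v| <= L * D} ->
  E * #|four_cycles S| <= #|S| * (2 * L ^ 2 * D ^ 3).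
Proof.
move=> n0 nED nd dS; have [->|E0] := posnP E; first by rewrite mul0n.
have le1 : #|four_cycles S| <= \sum_(x in S) \sum_(c in S) #|codeg S x c| ^ 2.
  rewrite pair_big /=; set P := fun p : T * T => (p.1 \in S) && (p.2 \in S).
  pose F (p : T * T) := setX [set p] (setX (codeg S p.1 p.2) (codeg S p.1 p.2)).
  have sub : four_cycles S \subset \bigcup_(p | P p) F p.
    apply/subsetP => -[p [b d]]; rewrite inE /= => /and5P[p1 p2 _ _ /andP[q1 q2]].
    apply/bigcupP; exists p; first by rewrite /P p1 p2.
    by rewrite !in_setX /= set11 q1 q2.
  apply: leq_trans (subset_leq_card sub) _; apply: leq_trans (card_bigcup_le _ _) _.
  by apply: leq_sum => p _; rewrite !cardsX cards1 mul1n mulnn.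
have one x : x \in S -> E * \sum_(c in S) #|codeg S x c| ^ 2 <= 2 * L ^ 2 * D ^ 3.
  move=> xS; have dx := dS _ xS.
  have sumc : \sum_(c in S) #|codeg S x c| <= (L * D) ^ 2.
    rewrite sum_codeg -mulnn; apply: leq_trans (leq_mul dx (leqnn _)).
    rewrite -sum_nat_const; apply: leq_sum => b; rewrite inE => /andP[bS _]; exact: dS.
  have cle c : #|codeg S x c| <= L * D.
    by apply: leq_trans dx; apply/subset_leq_card/subsetIl.
  pose H := [set c in S | D <= E * #|codeg S x c|].
  have cH : #|H| <= n.
    apply/ltnW; rewrite ltnNge; apply/negP => nH.
    have dens : {in H, forall c, #|nbh S x| <= L * E * #|nbh (nbh S x) c|}.
      move=> c; rewrite inE => /andP[cS big]; apply: leq_trans dx _.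
      rewrite -mulnA leq_mul2l; apply/orP; right; apply: leq_trans big _.
      rewrite leq_mul2l; apply/orP; right; apply/subset_leq_card/subsetP => y.
      by rewrite !inE => /andP[-> /andP[_ ->]].
    apply: (nd _ _ nH _ dens).
    have [c] := card_gt0P (leq_trans n0 nH); rewrite inE => /andP[cS big].
    rewrite -(leq_pmul2l E0) mulnC; apply: leq_trans nED _; apply: leq_trans big _.
    by rewrite leq_mul2l; apply/orP; right; apply/subset_leq_card/subsetIl.
  rewrite (bigID (mem H)) /= mulnDr.
  (* At most [n] vertices lie in [H], each contributing at most [(L * D) ^ 2], and [n * E <= D]. *)
  have t1 : E * \sum_(c in S | c \in H) #|codeg S x c| ^ 2 <= D * (L * D) ^ 2.
    apply: leq_trans (_ : E * (n * (L * D) ^ 2) <= _); last first.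
      by rewrite mulnA [E * n]mulnC leq_mul2r nED orbT.
    rewrite leq_mul2l; apply/orP; right.
    apply: leq_trans (_ : \sum_(c in H) (L * D) ^ 2 <= _); last first.
      by rewrite sum_nat_const leq_mul2r cH orbT.
    rewrite [X in X <= _](eq_bigl (mem H)); last by move=> c; rewrite !inE andbA andbb.
    by apply: leq_sum => c _; rewrite leq_exp2r.
  (* Outside [H] one factor of the square is below [D / E]; the other is summed by [sumc]. *)
  have t2 : E * \sum_(c in S | c \notin H) #|codeg S x c| ^ 2 <= D * (L * D) ^ 2.
    apply: leq_trans (_ : D * \sum_(c in S) #|codeg S x c| <= _); last first.
      by rewrite leq_mul2l sumc orbT.
    rewrite !big_distrr /= [X in _ <= X](bigID (mem H)) /=.
    apply: leq_trans (leq_addl _ _); apply: leq_sum => c /andP[cS].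
    rewrite inE cS /= -ltnNge => /ltnW lt.
    by rewrite -mulnn mulnA leq_mul2r lt orbT.
  have -> : 2 * L ^ 2 * D ^ 3 = D * (L * D) ^ 2 + D * (L * D) ^ 2.
    by rewrite addnn -mul2n expnMn expnS; lia.
  exact: leq_add.
apply: leq_trans (_ : E * \sum_(x in S) \sum_(c in S) #|codeg S x c| ^ 2 <= _).
  by rewrite leq_mul2l le1 orbT.
by rewrite big_distrr -sum_nat_const; apply: leq_sum => x; apply: one.
Qed.

(** Every vertex of a 4-cycle comes first in some labelling, so all vertices on 4-cycles of [V] are
    dropped. *)
Definition c4_free_part (V : {set T}) : {set T} :=
  [set x in V | [forall z in four_cycles V, z.1.1 != x]].

Lemma c4_free_partP (V : {set T}) : ~ has_C4_in e (c4_free_part V).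
Proof.
case=> [a [b [c [d [/and4P[aV bV cV dV] /= uni /and4P[ab bc cd da]]]]]].
move: uni; rewrite !inE !negb_or => /and4P[/and3P[_ nac _] /andP[_ nbd] _ _].
move: aV bV cV dV; rewrite !inE => /andP[aV /forallP h] /andP[bV _] /andP[cV _] /andP[dV _].
have := h ((a, c), (b, d)); rewrite inE /= nac nbd !inE /= aV bV cV dV ab.
by rewrite [e c b]e_sym bc cd [e a d]e_sym da eqxx.
Qed.

Definition c4_pendants (V : {set T}) : {set ((T * T) * (T * T)) * T} :=
  [set p in setX (four_cycles V) V | e p.1.1.1 p.2].

(** Each edge at a deleted vertex is charged to a 4-cycle starting there, giving a pendant. Degree
    sums see a lost edge from both ends, whence the factor 2. *)
Lemma edges_c4_free_part (V : {set T}) :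
  \sum_(x in V) #|nbh V x| <=
  \sum_(x in c4_free_part V) #|nbh (c4_free_part V) x| + 2 * #|c4_pendants V|.
Proof.
set W := c4_free_part V.
have WV : W \subset V by apply/subsetP => x; rewrite inE => /andP[].
pose B := V :\: W.
have split x : #|nbh V x| <= #|nbh W x| + #|nbh B x|.
  apply: leq_trans (leq_card_setU _ _); apply/subset_leq_card/subsetP => y.
  by rewrite !inE => /andP[-> ->]; rewrite !andbT; case: (_ && _); rewrite ?orbT.
have sumU (F : T -> nat) : \sum_(x in V) F x = \sum_(x in W) F x + \sum_(x in B) F x.
  rewrite (bigID (mem W)) /=; congr (_ + _); apply: eq_bigl => x.
    by rewrite andbC; case: (boolP (x \in W)) => //= /(subsetP WV) ->.
  by rewrite [RHS]in_setD andbC.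
have pend : \sum_(x in B) #|nbh V x| <= #|c4_pendants V|.
  pose F x := [set p in c4_pendants V | p.1.1.1 == x].
  rewrite -[X in _ <= X]sum1_card.
  rewrite [X in _ <= X](partition_big (fun p => p.1.1.1) (mem V)) /=; last first.
    by move=> p; rewrite !inE -!andbA => /and3P[].
  rewrite [X in _ <= X]sumU; apply: leq_trans (leq_addl _ _).
  apply: leq_sum => x; rewrite in_setD inE => /andP[+ xV].
  rewrite xV /= negb_forall => /existsP[z]; rewrite negb_imply negbK => /andP[zC /eqP zx].
  rewrite sum1dep_card -(@card_imset _ _ (fun y => (z, y))); last by move=> y y' [].
  apply/subset_leq_card/subsetP => _ /imsetP[y yN ->]; move: yN; rewrite inE => /andP[yV xy].
  by rewrite inE /= zx eqxx andbT inE in_setX zC yV /= zx.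
rewrite sumU.
have h1 : \sum_(x in W) #|nbh V x| <= \sum_(x in W) #|nbh W x| + \sum_(x in W) #|nbh B x|.
  by rewrite -big_split; apply: leq_sum => x _; apply: split.
have h2 : \sum_(x in W) #|nbh B x| <= \sum_(x in B) #|nbh V x|.
  by rewrite sum_nbh_swap //; apply: leq_sum => x _; apply/subset_leq_card/nbhS.
lia.
Qed.

Definition edge_pairs (V : {set T}) : {set T * T} := [set p in setX V V | e p.1 p.2].

Lemma card_edge_pairs (V : {set T}) : #|edge_pairs V| = \sum_(x in V) #|nbh V x|.
Proof.
rewrite -sum1_card (partition_big fst (mem V)) /=; last first.
  by move=> [x y]; rewrite inE in_setX /= => /andP[/andP[]].
apply: eq_bigr => x xV; rewrite sum1dep_card -[RHS](@card_imset _ _ (pair x)); last by move=> y y' [].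
apply: eq_card => -[x' y]; rewrite inE; apply/andP/imsetP.
  case; rewrite inE in_setX /= => /andP[/andP[_ yV] xy] /eqP <-.
  by exists y; rewrite // inE yV.
by case=> z; rewrite inE => /andP[zV xz] [-> ->]; rewrite inE in_setX xV zV /= xz.
Qed.

Lemma four_cycles_uniq (S : {set T}) z : z \in four_cycles S ->
  uniq [:: z.1.1; z.1.2; z.2.1; z.2.2].
Proof.
case: z => [[a c] [b d]]; rewrite inE /= !inE => /and5P[_ _ nac nbd].
case/andP => /andP[/andP[_ ab] /andP[_ cb]] /andP[/andP[_ ad] /andP[_ cd]].
have ne x y : e x y -> x != y by apply: contraTneq => ->; rewrite e_irr.
by rewrite !negb_or nac nbd !ne.
Qed.

Definition c4_support (p : ((T * T) * (T * T)) * T) : seq T :=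
  [:: p.1.1.1; p.1.1.2; p.1.2.1; p.1.2.2].

Lemma c4_pendantsP (S : {set T}) z y :
  ((z, y) \in c4_pendants S) = [&& z \in four_cycles S, y \in S & e z.1.1 y].
Proof. by rewrite inE in_setX andbA. Qed.

(** The edge either leaves the cycle, so that five vertices must survive the sampling, or stays on
    it, so that only four must; the two kinds are therefore counted separately. *)
Lemma card_pendants (S : {set T}) (d : nat) : {in S, forall v, #|nbh S v| <= d} ->
  #|[set p in c4_pendants S | p.2 \notin c4_support p]| <= d * #|four_cycles S| /\
  #|[set p in c4_pendants S | p.2 \in c4_support p]| <= 4 * #|four_cycles S|.
Proof.
move=> dS.
have fib (P : pred (((T * T) * (T * T)) * T)) n :
    (forall z, z \in four_cycles S -> #|[set y in nbh S z.1.1 | P (z, y)]| <= n) ->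
    #|[set p in c4_pendants S | P p]| <= n * #|four_cycles S|.
  move=> fibn.
  have subZ : [set fst p | p in [set p in c4_pendants S | P p]] \subset four_cycles S.
    apply/subsetP => _ /imsetP[[z y] + ->]; rewrite inE => /andP[+ _].
    by rewrite c4_pendantsP => /andP[].
  apply: leq_trans (_ : n * #|[set fst p | p in [set p in c4_pendants S | P p]]| <= _); last first.
    by rewrite leq_mul2l subset_leq_card // orbT.
  apply: card_fiber_le => z.
  case: (boolP (z \in four_cycles S)) => zZ; last first.
    rewrite (_ : [set x in _ | _] = set0) ?cards0 //; apply/setP => -[z' y].
    rewrite in_set0; apply: contraNF zZ => /setIdP[/setIdP[+ _] /eqP /= <-].
    by rewrite c4_pendantsP => /andP[].
  apply: leq_trans (fibn _ zZ); rewrite -(@card_in_imset _ _ snd); last first.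
    by move=> [a b] [a' b']; rewrite !inE /= => /andP[_ /eqP ->] /andP[_ /eqP ->] ->.
  apply/subset_leq_card/subsetP => _ /imsetP[[z' y] + ->].
  case/setIdP => /setIdP[+ Pzy] /eqP /= <-.
  by rewrite c4_pendantsP !inE Pzy => /and3P[_ -> ->].
split; apply: fib => z zZ.
  apply: leq_trans (dS z.1.1 _); first by apply/subset_leq_card/subsetP => y; rewrite inE => /andP[].
  by move: zZ; rewrite inE => /andP[].
apply: leq_trans (_ : #|[set x in c4_support (z, z.1.1)]| <= 4).
  by apply/subset_leq_card/subsetP => y; rewrite !inE => /andP[].
by rewrite cardsE; apply: card_size.
Qed.
Lemma four_cyclesI (S Z : {set T}) z : z \in four_cycles (S :&: Z) ->
  z \in four_cycles S /\ [/\ z.1.1 \in Z, z.1.2 \in Z, z.2.1 \in Z & z.2.2 \in Z].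
Proof.
case: z => [[a c] [b d]]; rewrite !inE /= -!andbA.
by do 17!(case/andP; let h := fresh in move=> h; rewrite ?h {h}); move=> ->.
Qed.

Lemma sum_edges_sampled (m : nat) (S : {set T}) :
  m.+1 ^ 2 * \sum_(f : {ffun T -> 'I_m.+1}) \sum_(x in S :&: zeros f) #|nbh (S :&: zeros f) x|
    = (\sum_(x in S) #|nbh S x|) * m.+1 ^ #|T|.
Proof.
rewrite -card_edge_pairs -(@sample_sum _ _ m 2 _ (fun p => [set x in [:: p.1; p.2]])).
  congr (_ * _); apply: eq_bigr => f _; rewrite -card_edge_pairs; apply: eq_card => -[x y].
  rewrite !inE /=; apply/andP/andP.
    case=> /andP[/andP[-> fx] /andP[-> fy]] ->; split=> //.
    by apply/subsetP => v; rewrite !inE => /orP[]/eqP ->.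
  case=> /andP[/andP[-> ->] ->] /subsetP h.
  by have := h x; have := h y; rewrite !inE !eqxx orbT => -> // ->.
move=> [x y]; rewrite inE in_setX /= => /andP[_ xy]; apply: card_set_seq.
by rewrite /= inE andbT; apply: contraTneq xy => ->; rewrite e_irr.
Qed.

Lemma sum_vertices_sampled (m : nat) (S : {set T}) :
  m.+1 * \sum_(f : {ffun T -> 'I_m.+1}) #|S :&: zeros f| = #|S| * m.+1 ^ #|T|.
Proof.
rewrite -(@sample_sum _ _ m 1 _ (fun x => [set x])) => [|x _]; last by rewrite cards1.
rewrite expn1; congr (_ * _); apply: eq_bigr => f _; apply: eq_card => x.
by rewrite in_setI !inE sub1set inE.
Qed.

Lemma sum_pendants_sampled (m d : nat) (S : {set T}) : {in S, forall v, #|nbh S v| <= d} ->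
  m.+1 ^ 5 * \sum_(f : {ffun T -> 'I_m.+1}) #|c4_pendants (S :&: zeros f)|
    <= (d + 4 * m.+1) * #|four_cycles S| * m.+1 ^ #|T|.
Proof.
move=> dS; have [le5 le4] := card_pendants dS.
set R5 := [set p in _ | _ \notin _] in le5; set R4 := [set p in _ | _ \in _] in le4.
pose s4 p := [set x in c4_support p]; pose s5 (p : ((T * T) * (T * T)) * T) := p.2 |: s4 p.
have uni p : p \in c4_pendants S -> #|s4 p| = 4.
  by case: p => z y; rewrite c4_pendantsP => /andP[/four_cycles_uniq u _]; apply: card_set_seq.
have S4 := @sample_sum T _ m 4 R4 s4 (fun p Hp => uni p (proj1 (setIdP Hp))).
have : {in R5, forall p, #|s5 p| = 5}.
  by move=> p /setIdP[/uni u np]; rewrite /s5 cardsU1 u inE np.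
move=> /(@sample_sum T _ m 5) S5.
have split (f : {ffun T -> 'I_m.+1}) : #|c4_pendants (S :&: zeros f)| <=
    #|[set p in R5 | s5 p \subset zeros f]| + #|[set p in R4 | s4 p \subset zeros f]|.
  apply: leq_trans (leq_card_setU _ _); apply/subset_leq_card/subsetP => -[z y].
  rewrite c4_pendantsP => /and3P[/four_cyclesI[zS [z1 z2 z3 z4]]].
  rewrite inE => /andP[yS yf] zy.
  have zyS : (z, y) \in c4_pendants S by rewrite c4_pendantsP zS yS.
  have sub4 : s4 (z, y) \subset zeros f.
    by move: z1 z2 z3 z4; rewrite !inE => *; apply/subsetP => v; rewrite in_set !inE => /or4P[]/eqP ->.
  apply/setUP; case: (boolP (y \in c4_support (z, y))) => ys; [right|left].
    by apply/setIdP; split=> //; apply/setIdP.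
  apply/setIdP; split; first exact/setIdP.
  by rewrite subUset sub1set yf.
apply: leq_trans (_ : m.+1 ^ 5 * (\sum_(f : {ffun T -> 'I_m.+1}) #|[set p in R5 | s5 p \subset zeros f]|
    + \sum_(f : {ffun T -> 'I_m.+1}) #|[set p in R4 | s4 p \subset zeros f]|) <= _).
  by rewrite leq_mul2l -big_split leq_sum ?orbT // => f _; apply: split.
rewrite mulnDr S5 expnS -mulnA S4 mulnA -mulnDl leq_mul2r; apply/orP; right.
by rewrite mulnDl leq_add // -mulnA mulnCA leq_mul2l le4 orbT.
Qed.
End Regular.

(** Sample with probability [1 / n], where [n] is about [D / (16 * k)]. The expected degree sum is
    at least [2 * k] times the expected number of vertices, and for large [E] the pendants of the
    few 4-cycles cost less than half of it. *)
Lemma regular_good (k L : nat) : 0 < k -> exists E : nat, forall (T : finType) (e : rel T),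
  symmetric e -> irreflexive e ->
  forall (n0 D : nat) (S : {set T}), 0 < n0 -> n0 * E <= D -> 16 * k <= D ->
    no_dense_pair e n0 (L * E) -> S != set0 ->
    {in S, forall v, #|nbh e S v| <= L * D} ->
    #|S| * D <= 8 * \sum_(v in S) #|nbh e S v| ->
  has_good e k.
Proof.
move=> k0; pose c := 2 * (32 * k * L + 4) * (2 * L ^ 2 * (32 ^ 3 * k ^ 3)).
exists c.+1 => T e e_sym e_irr n0 D S n00 nED kD nd S0 dS eS.
have cyc := card_four_cycles e_sym n00 nED nd dS.
have [n [n_gt0 nD Dn]] : exists n, [/\ 0 < n, n * (16 * k) <= D & D <= 32 * k * n].
  have n_gt0 : 0 < D %/ (16 * k) by rewrite divn_gt0; lia.
  exists (D %/ (16 * k)); split=> //; first exact: leq_trunc_div.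
  have := ltn_ceil D (_ : 0 < 16 * k); nia.
have [m nm] : exists m, n = m.+1 by exists n.-1; rewrite prednK.
have Sc : 0 < #|S| by rewrite card_gt0.
set E2 := \sum_(v in S) #|nbh e S v| in eS.
(* The comparison of expectations, multiplied by [n ^ 5]. *)
have main : k * #|S| * n ^ 4 + 2 * ((L * D + 4 * n) * #|four_cycles e S|) < E2 * n ^ 3.
  have h1 : 2 * k * #|S| * n ^ 4 <= E2 * n ^ 3.
    have : 2 * k * #|S| * n <= E2 by have := leq_mul (leqnn #|S|) nD; move: eS; clear; move: E2 => E2; lia.
    by move=> h; rewrite expnS mulnA leq_mul2r h orbT.
  have h2 : 2 * ((L * D + 4 * n) * #|four_cycles e S|) < k * #|S| * n ^ 4.
    rewrite -(@ltn_pmul2l c.+1) //.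
    have a1 : L * D + 4 * n <= (32 * k * L + 4) * n by nia.
    have a2 : D ^ 3 <= 32 ^ 3 * k ^ 3 * n ^ 3.
      by apply: leq_trans (leq_exp2rw 3 Dn) _; rewrite !expnMn.
    have a3 : c.+1 * #|four_cycles e S| <= #|S| * (2 * L ^ 2 * (32 ^ 3 * k ^ 3 * n ^ 3)).
      by apply: leq_trans cyc _; rewrite leq_mul2l leq_mul2l a2 !orbT.
    have a4 := leq_mul a1 a3.
    have a5 : 0 < #|S| * n ^ 4 by rewrite muln_gt0 Sc expn_gt0 n_gt0.
    have -> : c.+1 * (2 * ((L * D + 4 * n) * #|four_cycles e S|)) =
      2 * ((L * D + 4 * n) * (c.+1 * #|four_cycles e S|)) by lia.
    apply: leq_ltn_trans (_ : c * (#|S| * n ^ 4) < _).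
      apply: leq_trans (_ : 2 * ((32 * k * L + 4) * n * (#|S| * (2 * L ^ 2 * (32 ^ 3 * k ^ 3 * n ^ 3)))) <= _).
        by rewrite leq_mul2l a4.
      by rewrite /c expnS; lia.
    by rewrite -mulnA; nia.
  lia.
have [f _ fgood] : exists2 f : {ffun T -> 'I_m.+1}, true &
    k * #|S :&: zeros f| + 2 * #|c4_pendants e (S :&: zeros f)| <
    \sum_(x in S :&: zeros f) #|nbh e (S :&: zeros f) x|.
  apply: sum_lt_exists; rewrite -(@ltn_pmul2l (m.+1 ^ 5)) ?expn_gt0 //.
  rewrite big_split /= -!big_distrr /= mulnDr.
  have e1 := sum_vertices_sampled m S.
  have e2 := sum_edges_sampled e_irr m S.
  have e3 := sum_pendants_sampled e_irr m dS.
  move: e1 e2 e3; move: (\sum_(f : {ffun T -> 'I_m.+1}) #|S :&: zeros f|) => s1.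
  move: (\sum_(f : {ffun T -> 'I_m.+1}) \sum_(x in _) _) => s2.
  move: (\sum_(f : {ffun T -> 'I_m.+1}) #|c4_pendants e _|) => s3; rewrite -/E2 -nm => e1 e2 e3.
  have -> : n ^ 5 * (k * s1) = n ^ 4 * k * (n * s1) by rewrite [n ^ 5]expnS; lia.
  have -> : n ^ 5 * s2 = n ^ 3 * (n ^ 2 * s2) by rewrite mulnA -expnD.
  rewrite e1 e2.
  apply: leq_ltn_trans (_ : (k * #|S| * n ^ 4 + 2 * ((L * D + 4 * n) * #|four_cycles e S|)) * n ^ #|T| < _).
    rewrite mulnDl leq_add //; first by rewrite leq_eqVlt; apply/orP; left; apply/eqP; lia.
    by rewrite mulnCA -[X in _ <= X]mulnA leq_mul2l e3.
  by rewrite [X in _ < X]mulnA [n ^ 3 * E2]mulnC ltn_mul2r expn_gt0 n_gt0 main.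
have := edges_c4_free_part e_sym (S :&: zeros f).
set V := S :&: zeros f in fgood *; set W := c4_free_part e V => le.
have WV : #|W| <= #|V| by apply/subset_leq_card/subsetP => x; rewrite inE => /andP[].
have WW : k * #|W| < \sum_(x in W) #|nbh e W x| by nia.
exists W; split; first exact: c4_free_partP.
split; last exact: ltnW.
by apply: contraTneq WW => ->; rewrite big_set0.
Qed.

(** * Spread tuples *)

Definition sparse (T : finType) (e : rel T) (d : nat) : Prop :=
  forall Y : {set T}, \sum_(y in Y) #|nbh e Y y| <= d * #|Y|.

(** As [sparse] bounds the average degree on every subset, a vertex of degree at most [d] can always
    be removed and placed last. *)
Lemma degeneracy_order (T : finType) (e : rel T) (d : nat) : sparse e d ->
  exists2 r : T -> nat, injective r & forall x, #|[set y | e x y & r y < r x]| <= d.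
Proof.
move=> sp.
suff [r [rinj _ rd]] : exists r : T -> nat, [/\ {in [set: T] &, injective r},
    {in [set: T], forall x, r x < #|[set: T]|} &
    {in [set: T], forall x, #|[set y in [set: T] | e x y & r y < r x]| <= d}].
  exists r => [x y|x]; first by apply: rinj; rewrite inE.
  by apply: leq_trans (rd x (in_setT x)); apply/subset_leq_card/subsetP => y; rewrite !inE.
move: [set: T] => S; elim: {S}#|S| {-2}S (erefl #|S|) => [|n IH] S cS.
  exists (fun=> 0); move/eqP: cS; rewrite cards_eq0 => /eqP ->.
  by split=> x; rewrite inE.
have [v vS vd] : exists2 v, v \in S & #|nbh e S v| <= d.
  case: (pickP [pred v in S | #|nbh e S v| <= d]) => [v /andP[]|no]; first by exists v.
  have : \sum_(v in S) d.+1 <= \sum_(v in S) #|nbh e S v|.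
    by apply: leq_sum => v vS; have := no v; rewrite /= vS /= ltnNge => ->.
  by rewrite sum_nat_const => le; have := leq_trans le (sp S); rewrite cS mulnC leq_pmul2r // ltnn.
have cS' : #|S :\ v| = n by have := cardsD1 v S; rewrite vS cS => -[].
have [r [rinj rlt rd]] := IH _ cS'; rewrite cS' in rlt.
have inS x : x \in S -> x != v -> x \in S :\ v by rewrite !inE => -> ->.
exists (fun x => if x == v then n else r x); split.
- move=> x y xS yS /=; case: eqVneq => [->|xv]; case: eqVneq => [->|yv] //.
  + by move=> E; have := rlt _ (inS _ yS yv); rewrite -E ltnn.
  + by move=> E; have := rlt _ (inS _ xS xv); rewrite E ltnn.
  + by apply: rinj; apply: inS.
- by move=> x xS /=; rewrite cS; case: eqVneq => [_|xv] //; rewrite ltnW // ltnS rlt // inS.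
move=> x xS /=; case: eqVneq => [->|xv].
  by apply: leq_trans vd; apply/subset_leq_card/subsetP => y; rewrite !inE => /and3P[-> -> _].
apply: leq_trans (rd _ (inS _ xS xv)); apply/subset_leq_card/subsetP => y.
rewrite !inE => /and3P[yS -> ]; case: eqVneq => [_|yv] lt; last by rewrite yS lt.
by have := ltn_trans lt (rlt _ (inS _ xS xv)); rewrite ltnn.
Qed.

(** At least half of [A] has [R]-degree at most [2 * d]. A largest [R]-independent set of such
    vertices dominates all of them, each member accounting for at most [2 * d + 1]. *)
Lemma turan_greedy (T : finType) (R : rel T) (A : {set T}) (d : nat) : symmetric R ->
  \sum_(a in A) #|[set b in A | R a b]| <= d * #|A| ->
  exists I : {set T}, [/\ I \subset A, {in I &, forall a b, a != b -> ~~ R a b} &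
    #|A| <= 2 * (2 * d + 1) * #|I|].
Proof.
move=> Rsym sumA; pose L := [set a in A | #|[set b in A | R a b]| <= 2 * d].
have LA : L \subset A by apply/subsetP => a; rewrite inE => /andP[].
have cL : #|A| <= 2 * #|L|.
  have : (2 * d + 1) * #|A :\: L| <= d * #|A|.
    apply: leq_trans sumA; rewrite mulnC -sum_nat_const [X in _ <= X](bigID (mem L)) /=.
    apply: leq_trans (leq_addl _ _).
    rewrite [X in _ <= X](eq_bigl (mem (A :\: L))); last by move=> a; rewrite /= in_setD andbC.
    apply: leq_sum => a; rewrite in_setD inE => /andP[+ aA]; rewrite aA /= -ltnNge; lia.
  have := cardsID L A; rewrite (setIidPr LA); nia.
pose P (I : {set T}) := (I \subset L) && [forall a in I, forall b in I, (a != b) ==> ~~ R a b].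
have P0 : P set0 by rewrite /P sub0set; apply/forallP => a; rewrite inE.
case: (arg_maxnP (fun I : {set T} => #|I|) P0) => I /andP[IL /forallP indI] maxI.
have ind a b : a \in I -> b \in I -> a != b -> ~~ R a b.
  by move=> aI bI nab; have := indI a; rewrite aI /= => /forallP /(_ b); rewrite bI nab.
exists I; split; first exact: subset_trans LA.
  by move=> a b aI bI; apply: ind.
have cover : L \subset \bigcup_(i in I) (i |: [set b in A | R i b]).
  apply/subsetP => a aL; apply/negPn/negP => nU.
  have aN i : i \in I -> (a != i) && ~~ R i a.
    move=> iI; rewrite -negb_or; apply: contra nU => h; apply/bigcupP; exists i => //.
    by rewrite !inE (subsetP LA _ aL).
  have : #|a |: I| <= #|I|.
    apply: maxI; rewrite /P subUset sub1set aL IL /=.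
    apply/forallP => b; apply/implyP; rewrite !inE => hb; apply/forallP => b'; apply/implyP.
    rewrite !inE => hb'; apply/implyP => nbb.
    case/orP: hb => [/eqP bE|bI]; case/orP: hb' => [/eqP b'E|b'I].
    - by rewrite bE b'E eqxx in nbb.
    - by rewrite bE Rsym; have /andP[] := aN _ b'I.
    - by rewrite b'E; have /andP[] := aN _ bI.
    - exact: ind.
  rewrite cardsU1; case: (boolP (a \in I)) => [aI|_]; last by rewrite ltnn.
  by have := aN _ aI; rewrite eqxx.
apply: leq_trans cL _; rewrite -mulnA leq_mul2l /=.
apply: leq_trans (subset_leq_card cover) _; apply: leq_trans (card_bigcup_le _ _) _.
rewrite mulnC -sum_nat_const; apply: leq_sum => i iI.
rewrite cardsU1 addnC leq_add //; last by case: (_ \notin _).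
by have := subsetP IL _ iI; rewrite inE => /andP[].
Qed.

Section Sampling.
Variables (T : finType) (e : rel T).
Hypothesis (e_sym : symmetric e) (e_irr : irreflexive e).
Notation nbh := (nbh e).

Definition spread_tuples (k : nat) (A N : {set T}) (theta : nat) : {set {ffun 'I_k -> T}} :=
  [set w in tuples_in 'I_k N | [forall i, forall j, (i != j) ==>
    [&& w i != w j, ~~ e (w i) (w j) & #|codeg e A (w i) (w j)| < theta]]].

Lemma spread_tuplesP (k : nat) (A N : {set T}) (theta : nat) (w : {ffun 'I_k -> T}) :
  w \in spread_tuples k A N theta ->
  (forall i, w i \in N) /\ (forall i j, i != j ->
    [/\ w i != w j, ~~ e (w i) (w j) & #|codeg e A (w i) (w j)| < theta]).
Proof.
case/setIdP; rewrite inE => /forallP wN /forallP h; split=> // i j nij.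
by have := implyP (forallP (h i) j) nij => /and3P.
Qed.

(* Sample B with probability 1 / (C1 * D) and keep the vertices a of A whose trace on the sample is
   a spread k-tuple; vertices with two common sampled neighbours are few because codegrees of
   spread tuples are small, so a Turan argument removes them. *)
Lemma sampling_good (k c D rho theta : nat) (A B : {set T}) :
  let C1 := 2 * (4 + 2 * k) in let G := 2 * c * C1 ^ k * k ^ k in
  0 < k -> 0 < D -> sparse e D.+1 -> A != set0 ->
  {in A, forall a, #|nbh B a| <= 4 * D} ->
  #|A| * D ^ k <= c * \sum_(a in A) #|spread_tuples k A (nbh B a) theta| ->
  rho * #|B| <= #|A| ->
  4 * G * (2 * (D.+1 + k ^ 2 * theta) + 1) <= rho * (C1 * D) ->
  has_good e k.
Proof.
move=> C1 G k0 D0 sp A0 dA many AB big.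
have [r rinj rback] := degeneracy_order sp.
pose n := C1 * D.
have C10 : 0 < C1 by rewrite /C1; lia.
have [m nm] : exists m, n = m.+1 by exists n.-1; rewrite prednK // muln_gt0 C10.
pose back x := [set y in B | e x y & r y < r x].
have cback x : #|back x| <= 2 * D.
  apply: leq_trans (_ : D.+1 <= _); last by lia.
  apply: leq_trans (rback x); apply/subset_leq_card/subsetP => y.
  by rewrite !inE => /and3P[_ -> ->].
pose im (w : {ffun 'I_k -> T}) := [set w i | i : 'I_k].
pose P : {set T * {ffun 'I_k -> T}} :=
  [set p | (p.1 \in A) && (p.2 \in spread_tuples k A (nbh B p.1) theta)].
(* The vertices the sample must miss: the neighbours of [p.1] in [B] outside the tuple, and the back
   neighbours of its entries. *)
pose F (p : T * {ffun 'I_k -> T}) :=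
  (nbh B p.1 :|: \bigcup_i back (p.2 i)) :\: im p.2.
pose ev (f : {ffun T -> 'I_m.+1}) p := (im p.2 \subset zeros f) && [disjoint F p & zeros f].
have cim w a : w \in spread_tuples k A (nbh B a) theta -> #|im w| = k.
  move=> /spread_tuplesP[_ h]; rewrite card_imset ?card_ord // => i j E.
  by apply/eqP/negPn/negP => /h[]; rewrite E eqxx.
have cP : #|P| = \sum_(a in A) #|spread_tuples k A (nbh B a) theta|.
  rewrite -sum1_card (partition_big fst (mem A)) /=; last by move=> p; rewrite inE => /andP[].
  apply: eq_bigr => a aA; rewrite sum1dep_card -[RHS](@card_imset _ _ (pair a)); last by move=> y y' [].
  apply: eq_card => -[a' w]; apply/setIdP/imsetP => /=.
    by case=> + /eqP E; rewrite inE /= E => /andP[_ aw]; exists w.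
  by case=> w' w'S [-> ->]; rewrite inE /= aA w'S eqxx.
have inP a w : ((a, w) \in P) = (a \in A) && (w \in spread_tuples k A (nbh B a) theta).
  by rewrite inE.
have evcount p : p \in P ->
    n ^ #|T| <= 2 * n ^ k * #|[set f : {ffun T -> 'I_m.+1} | ev f p]|.
  case: p => a w; rewrite inE /= => /andP[aA wg].
  have dis : [disjoint im w & F (a, w)].
    by rewrite disjoint_sym disjoints_subset; apply/subsetP => x; rewrite in_setD in_setC => /andP[].
  have := card_sample m dis; rewrite (cim _ _ wg) nm.
  (* The constant [C1] is chosen so that [F], of size at most [(4 + 2 * k) * D], is missed with
     probability at least one half. *)
  have cF : 2 * #|F (a, w)| <= m.+1.
    have h1 : #|F (a, w)| <= #|nbh B a| + #|\bigcup_i back (w i)|.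
      apply: leq_trans (leq_card_setU _ _); apply/subset_leq_card/subsetDl.
    have h2 : #|\bigcup_i back (w i)| <= k * (2 * D).
      apply: leq_trans (card_bigcup_le _ _) _; rewrite -[k in X in _ <= X]card_ord -sum_nat_const.
      by apply: leq_sum => i _.
    have := dA _ aA; rewrite -nm /n /C1; clear -h1 h2; nia.
  have := bernoulli_half cF; rewrite expnD; set x := #|F (a, w)|.
  rewrite -[X in X * _ = _ -> _]/(#|[set f | ev f (a, w)]|); set y := #|[set f | ev f (a, w)]|.
  have nx : 0 < m.+1 ^ x by rewrite expn_gt0.
  move: (m.+1 ^ #|T|) (m.+1 ^ k) (m ^ x) nx; move: (m.+1 ^ x) => p q s t p0 h1 h2.
  rewrite -(leq_pmul2l p0); apply: leq_trans (_ : 2 * (t * q) <= _).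
    by rewrite mulnA leq_mul2r h1 orbT.
  by rewrite -h2; lia.
pose As (f : {ffun T -> 'I_m.+1}) := [set fst p | p in [set p in P | ev f p]].
(* The event forces the entries of [w] to be the trace of [nbh B a] on the sample, so each [a] has
   at most [k ^ k] tuples. *)
have X_le f : #|[set p in P | ev f p]| <= k ^ k * #|As f|.
  apply: card_fiber_le => a.
  have trace w : (a, w) \in P -> ev f (a, w) -> im w = nbh B a :&: zeros f.
    rewrite inP => /andP[_ /spread_tuplesP[wN _]] /andP[sub dis].
    apply/eqP; rewrite eqEsubset subsetI sub andbT; apply/andP; split.
      by apply/subsetP => _ /imsetP[i _ ->].
    apply/subsetP => x /setIP[xN xf]; apply/negPn/negP => xim.
    have xF : x \in F (a, w) by rewrite in_setD xim inE xN.
    by rewrite (disjointFr dis xF) in xf.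
  case: (set_0Vmem [set p in [set p in P | ev f p] | p.1 == a]) => [->|[[a0 w0]]]; first by rewrite cards0.
  case/setIdP => /setIdP[w0P w0e] /eqP /= a0E; subst a0.
  have ck : #|nbh B a :&: zeros f| = k.
    by rewrite -(trace _ w0P w0e); move: w0P; rewrite inP => /andP[_ h]; apply: cim h.
  rewrite -[X in _ <= X ^ k]ck -[k in X in _ <= X]card_ord -card_tuples_in.
  rewrite -(@card_in_imset _ _ snd); last first.
    by move=> [a1 w1] [a2 w2] /setIdP[_ /eqP /= ->] /setIdP[_ /eqP /= ->] /= ->.
  apply/subset_leq_card/subsetP => _ /imsetP[[a' w] /setIdP[/setIdP[h1 h2] /eqP /= E] ->]; subst a'.
  rewrite inE; apply/forallP => i; rewrite -(trace w h1 h2).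
  exact: imset_f.
have cA : 0 < #|A| by rewrite card_gt0.
have [f _ fgood] : exists2 f : {ffun T -> 'I_m.+1}, true &
    rho * n * #|B :&: zeros f| < 2 * G * #|As f|.
  apply: sum_lt_exists; rewrite -!big_distrr /= -mulnA.
  have e1 := sum_vertices_sampled m B; rewrite -[X in X * \sum_(_ | _) _]nm in e1.
  have e2 : #|A| * n ^ #|T| <= G * \sum_(f : {ffun T -> 'I_m.+1}) #|As f|.
    have s1 : #|P| * n ^ #|T| <= 2 * n ^ k * \sum_(f : {ffun T -> 'I_m.+1}) #|[set p in P | ev f p]|.
      rewrite (sum_card_swap predT (mem P) ev) /= big_distrr /= -sum_nat_const.
      by apply: leq_sum => p; apply: evcount.
    have s2 : \sum_(f : {ffun T -> 'I_m.+1}) #|[set p in P | ev f p]| <=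
        k ^ k * \sum_(f : {ffun T -> 'I_m.+1}) #|As f|.
      by rewrite big_distrr /=; apply: leq_sum => f _; apply: X_le.
    rewrite -cP in many.
    have Dk : 0 < D ^ k by rewrite expn_gt0 D0.
    rewrite -(leq_pmul2l Dk) mulnA [D ^ k * _]mulnC.
    apply: leq_trans (_ : c * #|P| * n ^ #|T| <= _); first by rewrite leq_mul2r many orbT.
    rewrite -mulnA; apply: leq_trans (_ : c * (2 * n ^ k * (k ^ k * \sum_(f : {ffun T -> 'I_m.+1}) #|As f|)) <= _).
      rewrite leq_mul2l; apply/orP; right; apply: leq_trans s1 _.
      by rewrite leq_mul2l s2 orbT.
    by rewrite /G /n expnMn; lia.
  rewrite e1; rewrite nm in e2; have nT : 0 < m.+1 ^ #|T| by rewrite expn_gt0.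
  rewrite mulnA; apply: leq_ltn_trans (_ : #|A| * m.+1 ^ #|T| < _).
    by rewrite leq_mul2r AB orbT.
  have h0 : 0 < #|A| * m.+1 ^ #|T| by rewrite muln_gt0 cA nT.
  have h1 := leq_trans h0 e2; apply: (leq_ltn_trans e2).
  by rewrite -[2 * G * _]mulnA mul2n -addnn -[X in X < _]addn0 ltn_add2l.
set Z := zeros f in fgood *; set A' := As f in fgood *.
have A'P a : a \in A' -> exists w, [/\ a \in A, w \in spread_tuples k A (nbh B a) theta,
    im w = nbh (B :&: Z) a & [disjoint F (a, w) & Z]].
  case/imsetP=> -[a0 w] /setIdP[+ /andP[sub dis]] /= ->; rewrite inP => /andP[aA wg].
  exists w; split=> //; have [wN _] := spread_tuplesP wg.
  apply/eqP; rewrite eqEsubset; apply/andP; split.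
    apply/subsetP => x xi; have xZ := subsetP sub _ xi; case/imsetP: xi => i _ xE.
    by have := wN i; rewrite -xE !inE => /andP[-> ->]; rewrite inE in xZ; rewrite xZ.
  apply/subsetP => x; rewrite !inE -andbA => /and3P[xB xf ax]; apply/negPn/negP => xim.
  have xF : x \in F (a0, w) by rewrite in_setD xim inE inE xB ax.
  by have := disjointFr dis xF; rewrite inE xf.
have A'A : A' \subset A by apply/subsetP => a /A'P[w []].
have A'0 : 0 < #|A'| by case: #|A'| fgood; rewrite ?muln0.
(* Two vertices conflict if they are adjacent or share two sampled neighbours. The sampled
   neighbours of [a] are the entries of its [w], so conflicts of the second kind lie in at most
   [k ^ 2] codegree sets of size below [theta]. *)
have [||I [IA' indI cI]] := @turan_greedy T (fun a a' => (a != a') &&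
  (e a a' || (1 < #|nbh (B :&: Z) a :&: nbh (B :&: Z) a'|))) A' (D.+1 + k ^ 2 * theta).
- by move=> a a' /=; rewrite eq_sym e_sym setIC.
- apply: leq_trans (_ : \sum_(a in A') (#|nbh A' a| + k ^ 2 * theta) <= _); last first.
    by rewrite big_split /= mulnDl sum_nat_const [#|A'| * _]mulnC leq_add2r; apply: sp.
  apply: leq_sum => a aA'; have [w [aA wg wtr _]] := A'P a aA'.
  have [wN wok] := spread_tuplesP wg.
  pose U := \bigcup_(ij : 'I_k * 'I_k | ij.1 != ij.2) codeg e A (w ij.1) (w ij.2).
  apply: leq_trans (_ : #|nbh A' a :|: U| <= _).
    apply/subset_leq_card/subsetP => b; rewrite inE => /andP[bA' /andP[_ /orP[ab|]]].
      by rewrite inE inE bA' ab.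
    case/card_gt1P=> u [v [/setIP[ua ub] /setIP[va vb] nuv]].
    apply/setUP; right; apply/bigcupP.
    move: ua va; rewrite -wtr => /imsetP[i _ uE] /imsetP[j _ vE].
    exists (i, j) => /=; first by apply: contraNneq nuv => ij; rewrite uE vE ij.
    move: ub vb; rewrite !inE -uE -vE (subsetP A'A _ bA') => /andP[_ bu] /andP[_ bv].
    by rewrite [e u b]e_sym [e v b]e_sym bu bv.
  apply: leq_trans (leq_card_setU _ _) _; rewrite leq_add2l.
  apply: leq_trans (card_bigcup_le _ _) _.
  apply: leq_trans (_ : \sum_(ij : 'I_k * 'I_k) theta <= _); last first.
    by rewrite sum_nat_const card_prod card_ord mulnn.
  rewrite [X in _ <= X](bigID (fun ij : 'I_k * 'I_k => ij.1 != ij.2)) /=.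
  apply: leq_trans (leq_addr _ _); apply: leq_sum => ij nij.
  by have [_ _ /ltnW] := wok _ _ nij.
(* Of two adjacent vertices of [B] one is a back neighbour of the other, so [B'] is independent. *)
pose B' := [set x in B :&: Z | [disjoint back x & Z]].
have cB' : #|B'| <= #|I|.
  apply: leq_trans (_ : #|B :&: Z| <= _).
    by apply/subset_leq_card/subsetP => x; rewrite inE => /andP[].
  have n0 : 0 < rho * n.
    by apply: leq_trans big; rewrite muln_gt0; move: fgood; case: (G) => //; rewrite !muln0.
  apply/ltnW; rewrite -(ltn_pmul2l n0); apply: leq_trans fgood _.
  apply: leq_trans (_ : 2 * G * (2 * (2 * (D.+1 + k ^ 2 * theta) + 1) * #|I|) <= _).
    by rewrite leq_mul2l cI orbT.
  by rewrite mulnA leq_mul2r; apply/orP; right; apply: leq_trans big; rewrite -/n; lia.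
have I0 : I != set0.
  by apply: contraTneq A'0 => I0; move: cI; rewrite I0 cards0 muln0 -leqNgt.
have nbB' a : nbh B' a \subset nbh (B :&: Z) a.
  by apply: nbhS; apply/subsetP => x; rewrite inE => /andP[].
apply: (@bip_good _ e e_sym k B' I) => //.
- move=> x x' /setIdP[/setIP[xB xZ] xd] /setIdP[/setIP[x'B x'Z] x'd]; apply/negP => xx'.
  case: (ltngtP (r x) (r x')) => [lt|lt|/rinj E]; last by rewrite E e_irr in xx'.
    have xb : x \in back x' by rewrite inE xB e_sym xx' lt.
    by rewrite (disjointFr x'd xb) in xZ.
  have xb : x' \in back x by rewrite inE x'B xx' lt.
  by rewrite (disjointFr xd xb) in x'Z.
- move=> a a' aI a'I; have [->|naa] := eqVneq a a'; first by rewrite e_irr.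
  by have := indI a a' aI a'I naa; rewrite naa /= negb_or => /andP[].
- move=> a aI; have [w [aA wg wtr dis]] := A'P a (subsetP IA' _ aI).
  have [wN wok] := spread_tuplesP wg.
  rewrite -(cim _ _ wg); apply/subset_leq_card/subsetP => x xim.
  have := xim; rewrite {1}wtr inE => /andP[xBZ ax]; rewrite inE ax andbT inE xBZ /=.
  case/imsetP: (xim) => i _ xE.
  rewrite disjoint_subset; apply/subsetP => y yb; rewrite inE; apply/negP => yZ.
  have yF : y \notin F (a, w) by apply/negP => h; rewrite (disjointFr dis h) in yZ.
  have yim : y \in im w.
    apply: contraR yF => nyim; rewrite in_setD nyim; apply/setUP; right.
    by apply/bigcupP; exists i; rewrite // -xE.
  case/imsetP: yim => j _ yE; move: yb; rewrite inE => /and3P[_ xy _].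
  have [ij|nij] := eqVneq i j; first by rewrite xE yE ij e_irr in xy.
  by have [_ /negP + _] := wok _ _ nij; apply; rewrite -xE -yE.
move=> a a' aI a'I naa; have := indI a a' aI a'I naa.
rewrite naa /= negb_or -leqNgt => /andP[_ le]; apply: leq_trans le.
by apply/subset_leq_card/setISS.
Qed.
End Sampling.

(** * Rich tuples *)

Lemma card_pull (T J Q : finType) (N : {set T}) (sg : J -> Q) (R : {set {ffun J -> T}}) :
  injective sg -> R \subset tuples_in J N ->
  #|[set x in tuples_in Q N | [ffun j => x (sg j)] \in R]| = #|R| * #|N| ^ (#|Q| - #|J|).
Proof.
move=> sgI RN; rewrite -[LHS]sum1_card.
rewrite (partition_big (fun x : {ffun Q -> T} => [ffun j => x (sg j)]) (mem R)) /=; last first.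
  by move=> x /setIdP[].
rewrite -sum_nat_const; apply: eq_bigr => w wR; rewrite sum1dep_card.
pose F (q : Q) : {pred T} := if [pick j | sg j == q] is Some j then pred1 (w j) else mem N.
have pickE j : [pick i | sg i == sg j] = Some j.
  by case: pickP => [i /eqP /sgI -> //|/(_ j)]; rewrite eqxx.
have -> : #|[set x | (x \in [set x in tuples_in Q N | [ffun j => x (sg j)] \in R]) &&
    ([ffun j => x (sg j)] == w)]| = #|family F|.
  apply: eq_card => x; apply/setIdP/familyP.
    case=> /setIdP[xN _] /eqP E q; rewrite /F; case: pickP => [j /eqP <-|_].
      by rewrite inE -E ffunE.
    by move: xN; rewrite inE => /forallP.
  move=> h; have E : [ffun j => x (sg j)] = w.
    apply/ffunP => j; rewrite ffunE; have := h (sg j); rewrite /F pickE inE => /eqP //.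
  split; last exact/eqP.
  apply/setIdP; split; last by rewrite E.
  rewrite inE; apply/forallP => q; have := h q; rewrite /F; case: pickP => [j _|_] //.
  by rewrite inE => /eqP ->; move: (subsetP RN _ wR); rewrite inE => /forallP.
rewrite card_family foldrE big_image /= (bigID (mem [set sg j | j : J])) /=.
rewrite big1 ?mul1n; last first.
  by move=> q /imsetP[j _ ->]; rewrite /F pickE card1.
rewrite (eq_bigr (fun=> #|N|)); last first.
  move=> q qn; rewrite /F; case: pickP => [j /eqP E|_] //.
  by case/imsetP: qn; exists j.
rewrite prod_nat_const; congr (_ ^ _).
have -> : #|[pred i | i \notin [set sg j | j : J]]| = #|~: [set sg j | j : J]|.
  by apply: eq_card => q; rewrite !inE.
by rewrite cardsCs setCK card_imset.
Qed.

Lemma card_pair_tuples (T Q : finType) (N : {set T}) (i j : Q) (P : rel T) : i != j ->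
  #|[set w in tuples_in Q N | P (w i) (w j)]| =
  #|[set p in setX N N | P p.1 p.2]| * #|N| ^ (#|Q| - 2).
Proof.
move=> nij; pose sg (b : bool) := if b then i else j.
pose R := [set y in tuples_in bool N | P (y true) (y false)].
have sgI : injective sg.
  by case=> -[] //= E; move: nij; rewrite E eqxx.
have RN : R \subset tuples_in bool N by apply/subsetP => y /setIdP[].
have := card_pull sgI RN; rewrite card_bool.
have -> : #|R| = #|[set p in setX N N | P p.1 p.2]|.
  rewrite -(@card_imset _ _ (fun y : {ffun bool -> T} => (y true, y false))); last first.
    by move=> y y' [E1 E2]; apply/ffunP => -[].
  apply: eq_card => -[u v]; apply/imsetP/setIdP.
    by case=> y /setIdP[]; rewrite inE => /forallP yN yP [-> ->]; rewrite in_setX !yN.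
  rewrite in_setX /= => -[/andP[uN vN] Puv]; exists [ffun b : bool => if b then u else v].
    by apply/setIdP; rewrite !ffunE inE; split=> //; apply/forallP => -[]; rewrite ffunE.
  by rewrite !ffunE.
move=> <-; apply: eq_card => x; apply/setIdP/setIdP => -[xN h]; split=> //.
  apply/setIdP; rewrite !ffunE inE; split=> //; apply/forallP => b; rewrite ffunE.
  by move: xN; rewrite inE => /forallP.
by case/setIdP: h; rewrite !ffunE.
Qed.

Section RichPairs.
Variables (T : finType) (e : rel T).
Hypothesis (e_sym : symmetric e) (e_irr : irreflexive e).
Notation nbh := (nbh e).

Definition inner_edges (N : {set T}) : {set T * T} := [set p in setX N N | e p.1 p.2].

Definition rich_pairs (A N : {set T}) (theta : nat) : {set T * T} :=
  [set p in setX N N | theta <= #|codeg e A p.1 p.2|].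

(** A tuple that is not spread has two entries that are equal, adjacent or of codegree at least
    [theta], in one of at most [k ^ 2] pairs of positions. *)
Lemma spread_or_rich (k theta : nat) (A N : {set T}) : 1 < k ->
  #|N| ^ k <= #|spread_tuples e k A N theta| +
    k ^ 2 * ((#|N| + #|inner_edges N| + #|rich_pairs A N theta|) * #|N| ^ (k - 2)).
Proof.
move=> k1; pose P u v := [|| u == v, e u v | theta <= #|codeg e A u v|].
pose bad (ij : 'I_k * 'I_k) := [set w in tuples_in 'I_k N | P (w ij.1) (w ij.2)].
have cP : #|[set p in setX N N | P p.1 p.2]| <= #|N| + #|inner_edges N| + #|rich_pairs A N theta|.
  have -> : #|N| = #|[set (u, u) | u in N]| by rewrite card_imset // => u v [].
  apply: leq_trans (_ : #|[set (u, u) | u in N] :|: inner_edges N :|: rich_pairs A N theta| <= _).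
    apply/subset_leq_card/subsetP => -[u v] /setIdP[uv /or3P[/eqP /= uvE|h|h]].
    - apply/setUP; left; apply/setUP; left; apply/imsetP; exists u; rewrite -?uvE //.
      by move: uv; rewrite in_setX => /andP[].
    - by apply/setUP; left; apply/setUP; right; apply/setIdP.
    - by apply/setUP; right; apply/setIdP.
  apply: leq_trans (leq_card_setU _ _) _; rewrite leq_add2r; exact: leq_card_setU.
have cover : tuples_in 'I_k N \subset
    spread_tuples e k A N theta :|: \bigcup_(ij | ij.1 != ij.2) bad ij.
  apply/subsetP => w wN; apply/setUP.
  case: (boolP (w \in spread_tuples e k A N theta)) => ws; [by left|right].
  move: ws; rewrite inE wN /= negb_forall => /existsP[i]; rewrite negb_forall => /existsP[j].
  rewrite negb_imply => /andP[nij h]; apply/bigcupP; exists (i, j) => //.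
  apply/setIdP; split=> //=; move: h; rewrite !negb_and !negbK -leqNgt; exact.
rewrite -[k in X in X <= _]card_ord -card_tuples_in.
apply: leq_trans (subset_leq_card cover) _; apply: leq_trans (leq_card_setU _ _) _.
rewrite leq_add2l; apply: leq_trans (card_bigcup_le _ _) _.
have -> : k ^ 2 = #|{: 'I_k * 'I_k}| by rewrite card_prod card_ord mulnn.
rewrite -sum_nat_const [X in _ <= X](bigID (fun ij : 'I_k * 'I_k => ij.1 != ij.2)) /=.
apply: leq_trans (leq_addr _ _); apply: leq_sum => ij nij.
by rewrite /bad card_pair_tuples // card_ord leq_mul2r cP orbT.
Qed.

(** Without a good subgraph [sampling_good] leaves few spread tuples, so most tuples contain a pair
    as in [spread_or_rich]. The bounds involving [E] make equal and adjacent pairs too rare to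
    account for this. *)
Lemma many_rich_pairs (k g D rho theta : nat) (A B : {set T}) :
  let C1 := 2 * (4 + 2 * k) in let G := 2 * (4 * g ^ k) * C1 ^ k * k ^ k in
  let E := 4 * g ^ k * k ^ 2 * 4 ^ k in
  1 < k -> 4 * E <= D -> 0 < D -> sparse e D.+1 -> A != set0 -> ~ has_good e k ->
  {in A, forall a, D <= g * #|nbh B a|} ->
  {in A, forall a, #|nbh B a| <= 4 * D} ->
  {in A, forall a, E * #|inner_edges (nbh B a)| <= D ^ 2} ->
  rho * #|B| <= #|A| ->
  4 * G * (2 * (D.+1 + k ^ 2 * theta) + 1) <= rho * (C1 * D) ->
  #|A| * D ^ 2 <= E * \sum_(a in A) #|rich_pairs A (nbh B a) theta|.
Proof.
move=> C1 G E k1 ED D0 sp A0 ng gA dA eA AB num.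
have few : 4 * g ^ k * \sum_(a in A) #|spread_tuples e k A (nbh B a) theta| < #|A| * D ^ k.
  rewrite ltnNge; apply/negP => many; apply: ng.
  by apply: (sampling_good e_sym e_irr _ D0 sp A0 dA many AB num); apply: ltnW.
set r := (fun a => #|rich_pairs A (nbh B a) theta|).
have one a : a \in A -> 2 * D ^ k <= 4 * g ^ k * #|spread_tuples e k A (nbh B a) theta| +
    D ^ (k - 2) * (E * r a).
  move=> aA; have := spread_or_rich theta A (nbh B a) k1.
  have := gA _ aA; have := dA _ aA; have := eA _ aA; rewrite -/(r a).
  set n := #|nbh B a|; set i := #|inner_edges _|; set st := #|spread_tuples _ _ _ _ _|.
  move=> hi hn hg h.
  have h1 : D ^ k <= g ^ k * n ^ k by rewrite -expnMn leq_exp2rw.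
  have h2 : n ^ (k - 2) <= 4 ^ (k - 2) * D ^ (k - 2) by rewrite -expnMn leq_exp2rw.
  have kk : D ^ k = D ^ (k - 2) * D ^ 2 by rewrite -expnD subnK.
  have k4 : 4 ^ (k - 2) * 16 = 4 ^ k by rewrite -[16]/(4 ^ 2) -expnD subnK.
  have nD : E * n <= D ^ 2.
    by rewrite -mulnn; apply: leq_trans (leq_mul (leqnn E) hn) _; rewrite mulnA [E * 4]mulnC leq_mul2r ED orbT.
  have s1 : 4 * D ^ k <= 4 * g ^ k * st + 4 * g ^ k * (k ^ 2 * ((n + i + r a) * (4 ^ (k - 2) * D ^ (k - 2)))).
    rewrite -mulnDr -mulnA leq_mul2l /=; apply: leq_trans h1 _; rewrite leq_mul2l.
    apply/orP; right; apply: leq_trans h _; rewrite leq_add2l leq_mul2l leq_mul2l h2.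
    by rewrite !orbT.
  have s2 : 16 * (4 * g ^ k * (k ^ 2 * ((n + i + r a) * (4 ^ (k - 2) * D ^ (k - 2)))))
      = D ^ (k - 2) * (E * n + E * i + E * r a).
    by rewrite /E -k4; lia.
  have s3 : D ^ (k - 2) * (E * n + E * i + E * r a) <= 2 * D ^ k + D ^ (k - 2) * (E * r a).
    rewrite mulnDr leq_add2r kk mulnCA leq_mul2l; apply/orP; right.
    by rewrite mul2n -addnn leq_add.
  lia.
have tot : 2 * (#|A| * D ^ k) <= 4 * g ^ k * \sum_(a in A) #|spread_tuples e k A (nbh B a) theta| +
    D ^ (k - 2) * (E * \sum_(a in A) r a).
  rewrite mulnCA -sum_nat_const !big_distrr -big_split; exact: leq_sum.
have kk : D ^ k = D ^ (k - 2) * D ^ 2 by rewrite -expnD subnK.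
have Dk : 0 < D ^ (k - 2) by rewrite expn_gt0 D0.
rewrite -[X in _ <= _ * X]/(\sum_(a in A) r a) -(leq_pmul2l Dk) mulnCA -kk.
by move: tot few; clear; lia.
Qed.
End RichPairs.

Definition rich_tuples (T : finType) (e : rel T) (j : nat) (A N : {set T}) (M : nat) :
  {set {ffun 'I_j -> T}} := [set w in tuples_in 'I_j N | M <= #|com e A w [set: 'I_j]|].

(** Common neighbours taken in [A' u] are also adjacent to [u], so prepending [u] keeps the tuple
    rich; the first entry separates the contributions of different [u]. *)
Lemma rich_tuplesS (T : finType) (e : rel T) (j M : nat) (A N U : {set T}) (A' N' : T -> {set T}) :
  symmetric e -> U \subset N -> {in U, forall u, A' u \subset nbh e A u} ->
  {in U, forall u, N' u \subset N} ->
  \sum_(u in U) #|rich_tuples e j (A' u) (N' u) M| <= #|rich_tuples e j.+1 A N M|.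
Proof.
move=> e_sym UN A'A N'N; rewrite -[X in _ <= X]sum1_card.
rewrite (bigID (fun x : {ffun 'I_j.+1 -> T} => x ord0 \in U)) /=.
apply: leq_trans (leq_addr _ _).
rewrite (partition_big (fun x : {ffun 'I_j.+1 -> T} => x ord0) (mem U)) /=; last first.
  by move=> x /andP[].
apply: leq_sum => u uU; rewrite sum1dep_card.
pose cons (x : {ffun 'I_j -> T}) := [ffun i => oapp x u (unlift ord0 i)].
rewrite -(@card_imset _ _ cons); last first.
  move=> x x' /ffunP E; apply/ffunP => i.
  by move: (E (lift ord0 i)); rewrite !ffunE liftK.
apply/subset_leq_card/subsetP => z /imsetP[x /setIdP[xt xM] -> {z}].
have xN i : x i \in N' u by move: xt; rewrite inE => /forallP.
rewrite inE ffunE unlift_none /= uU eqxx !andbT; apply/setIdP; split.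
  rewrite inE; apply/forallP => i; rewrite ffunE; case: unliftP => [i' _|_] /=.
    exact: subsetP (N'N _ uU) _ (xN i').
  exact: subsetP UN _ uU.
apply: leq_trans xM _; apply/subset_leq_card/subsetP => y /setIdP[yA' /forallP yx].
have /setIdP[yA uy] := subsetP (A'A _ uU) _ yA'.
apply/setIdP; split=> //; apply/forallP => i; rewrite inE /= ffunE.
case: unliftP => [i' _|_] /=; last by rewrite e_sym.
by have := yx i'; rewrite inE.
Qed.

Lemma card_set_pairs (T : finType) (N : {set T}) (r : rel T) :
  #|[set p in setX N N | r p.1 p.2]| = \sum_(u in N) #|[set v in N | r u v]|.
Proof.
rewrite -sum1_card (partition_big fst (mem N)) /=; last first.
  by move=> [u v] /setIdP[]; rewrite in_setX => /andP[].
apply: eq_bigr => u uN; rewrite sum1dep_card -[RHS](@card_imset _ _ (pair u)); last by move=> v v' [].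
apply: eq_card => -[u' v]; apply/setIdP/imsetP => /=.
  case=> /setIdP[]; rewrite in_setX /= => /andP[_ vN] h /eqP E; subst u'.
  by exists v => //; apply/setIdP.
by case=> v' /setIdP[v'N h] [-> ->]; rewrite eqxx; split=> //; apply/setIdP; rewrite in_setX uN v'N.
Qed.

(* Rich pairs are localised: for many u the pair (A_u, B_u), with A_u the neighbours of u in A and B_u
   the vertices of large codegree with u, inherits the hypotheses with worse constants, and
   prepending u to a rich j-tuple for that pair gives a rich (j+1)-tuple. *)
Lemma many_rich_tuples (k j : nat) : 1 < k -> forall g, exists rho E C, forall (T : finType) (e : rel T),
  symmetric e -> irreflexive e -> forall (D M : nat) (A B : {set T}),
  C <= D -> M <= D -> sparse e D.+1 -> ~ has_good e k -> A != set0 ->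
  {in A, forall a, D <= g * #|nbh e B a|} -> {in A, forall a, #|nbh e B a| <= 4 * D} ->
  rho * #|B| <= #|A| -> {in A, forall a, E * #|inner_edges e (nbh e B a)| <= D ^ 2} ->
  #|A| * D ^ j <= E * \sum_(a in A) #|rich_tuples e j A (nbh e B a) M|.
Proof.
move=> k1; elim: j => [|j IH] g.
  (* For [j = 0] the empty tuple is rich, because [#|A| >= g * #|B| >= D >= M]. *)
  exists g, 1, 0 => T e _ _ D M A B _ MD _ _ /set0Pn[a0 a0A] gA _ AB _.
  rewrite muln1 mul1n -[X in X <= _]muln1 -sum_nat_const; apply: leq_sum => a aA.
  rewrite card_gt0; apply/set0Pn; exists [ffun i : 'I_0 => a].
  apply/setIdP; split; first by rewrite inE; apply/forallP => -[].
  apply: leq_trans MD _; apply: leq_trans (gA _ a0A) _.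
  apply: leq_trans (_ : #|A| <= _).
    by apply: leq_trans AB; rewrite leq_mul2l subset_leq_card ?orbT ?nbh_sub.
  by apply/subset_leq_card/subsetP => y yA; apply/setIdP; split=> //; apply/forallP => -[].
pose E0 := 4 * g ^ k * k ^ 2 * 4 ^ k; pose h := 64 * E0.
have [rho' [E' [C' IHg]]] := IH (8 * E0).
(* Tuned to give [rho' * #|Bu u| <= #|Au u|]: counting edges between [Bu u] and [nbh e A u] gives
   [theta * #|Bu u| <= 4 * D * #|nbh e A u|], which for good [u] is at most
   [4 * D * h * #|Au u|]. *)
pose vt := 4 * h * rho'.
pose C1 := 2 * (4 + 2 * k); pose G := 2 * (4 * g ^ k) * C1 ^ k * k ^ k.
exists (4 * G * (5 + 2 * (k ^ 2 * vt))), (16 * E0 * E' + E0 + E'), (C' + 4 * E0 + 1).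
move=> T e e_sym e_irr D M A B CD MD sp ng A0 gA dA AB eA.
have D0 : 0 < D by lia.
pose theta := vt * D.
have eA0 : {in A, forall a, E0 * #|inner_edges e (nbh e B a)| <= D ^ 2}.
  by move=> a aA; apply: leq_trans (eA _ aA); rewrite leq_mul2r; lia.
have eA' : {in A, forall a, E' * #|inner_edges e (nbh e B a)| <= D ^ 2}.
  by move=> a aA; apply: leq_trans (eA _ aA); rewrite leq_mul2r; lia.
have g0 : 0 < g.
  by case/set0Pn: A0 => a /gA; case: (g) => //; rewrite mul0n leqNgt D0.
have E00 : 0 < E0 by rewrite /E0 !muln_gt0 !expn_gt0 g0; lia.
have pairs : #|A| * D ^ 2 <= E0 * \sum_(a in A) #|rich_pairs e A (nbh e B a) theta|.
  apply: (many_rich_pairs e_sym e_irr k1 _ D0 sp A0 ng gA dA eA0 AB); first by rewrite -/E0; lia.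
  rewrite -/C1 -/G -[X in _ <= X]mulnA leq_mul2l; apply/orP; right.
  apply: leq_trans (_ : (5 + 2 * (k ^ 2 * vt)) * D <= _).
    by rewrite /theta; move: (k ^ 2) (vt) D0 => a b d0; clear -d0; lia.
  by rewrite leq_mul2l leq_pmull ?orbT // /C1; lia.
pose Bu u := [set w in B | theta <= #|codeg e A u w|].
(* Keeps the lower degree bound for the smaller pair, with [8 * E0] in the role of [g]. *)
pose Au u := [set a in nbh e A u | D <= 8 * E0 * #|nbh e (Bu u) a|].
have AuA u a : a \in Au u -> a \in A by case/setIdP => /setIdP[].
have BuB u : Bu u \subset B by apply/subsetP => w /setIdP[].
have swap (F : T -> T -> nat) :
    \sum_(a in A) \sum_(u in nbh e B a) F u a = \sum_(u in B) \sum_(a in nbh e A u) F u a.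
  rewrite (exchange_big_dep (mem B)) /=; last by move=> a u _ /setIdP[].
  by apply: eq_bigr => u uB; apply: eq_bigl => a; rewrite !inE uB /= e_sym.
have degs : \sum_(u in B) #|nbh e A u| <= #|A| * (4 * D).
  rewrite -(sum_nbh_swap e_sym A B) -sum_nat_const; exact: leq_sum.
have pairsE : \sum_(a in A) #|rich_pairs e A (nbh e B a) theta| =
    \sum_(u in B) \sum_(a in nbh e A u) #|nbh e (Bu u) a|.
  rewrite -swap; apply: eq_bigr => a aA; rewrite (card_set_pairs _ (fun u v => theta <= #|codeg e A u v|)).
  apply: eq_bigr => u uN; apply: eq_card => v; rewrite !inE; rewrite -!andbA; congr andb.
  by rewrite andbC.
have many : #|A| * D <= 8 * E0 * \sum_(u in B) #|Au u|.
  have one u : u \in B -> 8 * E0 * \sum_(a in nbh e A u) #|nbh e (Bu u) a| <=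
      32 * E0 * D * #|Au u| + D * #|nbh e A u|.
    move=> uB; have cAu : \sum_(a in nbh e A u) (a \in Au u : nat) = #|Au u|.
      rewrite -sum1_card [RHS](eq_bigl (fun a => (a \in nbh e A u) && (a \in Au u))); last first.
        by move=> a; rewrite andb_idl // => /setIdP[].
      by rewrite big_mkcondr; apply: eq_bigr => a _; case: (a \in _).
    rewrite -cAu mulnC [D * _]mulnC -sum_nat_const mulnC !big_distrr -big_split /=.
    apply: leq_sum => a aN; case: (boolP (a \in Au u)) => [aAu|].
      have : #|nbh e (Bu u) a| <= 4 * D.
        apply: leq_trans (dA _ (AuA _ _ aAu)); apply/subset_leq_card/nbhS/BuB.
      by move=> /(leq_mul (leqnn (8 * E0))); clear; lia.
    by rewrite inE aN /= -ltnNge muln0 => /ltnW.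
  have : 8 * E0 * \sum_(u in B) \sum_(a in nbh e A u) #|nbh e (Bu u) a| <=
      32 * E0 * D * \sum_(u in B) #|Au u| + D * \sum_(u in B) #|nbh e A u|.
    by rewrite !big_distrr -big_split; apply: leq_sum.
  move: pairs degs; rewrite pairsE -mulnn -(leq_pmul2l D0).
  move: (\sum_(u in B) \sum_(a in _) _) (\sum_(u in B) #|Au u|) (\sum_(u in B) #|nbh e A u|).
  move=> x y z h1 h2 h3; rewrite -(@leq_pmul2l (4 * D)) ?muln_gt0 ?D0 //; clear -h1 h2 h3 D0.
  nia.
(* The other [u] contribute at most [4 * D * #|A| / h] to the sum of [#|Au u|]; [h = 64 * E0] makes
   this at most half of the lower bound in [many]. *)
pose good u := #|nbh e A u| <= h * #|Au u|.
have manyg : #|A| * D <= 16 * E0 * \sum_(u in B | good u) #|Au u|.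
  have bad : h * \sum_(u in B | ~~ good u) #|Au u| <= #|A| * (4 * D).
    apply: leq_trans degs; rewrite big_distrr [X in _ <= X](bigID good) /=.
    apply: leq_trans (leq_addl _ _); apply: leq_sum => u /andP[_].
    by rewrite /good -ltnNge => /ltnW.
  by move: many; rewrite (bigID good) /=; move: bad; rewrite /h; clear; lia.
have rec u : u \in B -> good u -> #|Au u| * D ^ j <=
    E' * \sum_(a in Au u) #|rich_tuples e j (Au u) (nbh e (Bu u) a) M|.
  move=> uB gu; have [->|Au0] := eqVneq (Au u) set0; first by rewrite cards0 mul0n.
  apply: IHg => //; first by lia.
  - by move=> a /setIdP[].
  - by move=> a aAu; apply: leq_trans (dA _ (AuA _ _ aAu)); apply/subset_leq_card/nbhS/BuB.
  - have cod : theta * #|Bu u| <= #|nbh e A u| * (4 * D).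
      apply: leq_trans (_ : \sum_(w in B) #|codeg e A u w| <= _).
        rewrite mulnC -sum_nat_const [X in _ <= X](bigID (mem (Bu u))) /=.
        apply: leq_trans (leq_addr _ _).
        rewrite [X in _ <= X](eq_bigl (mem (Bu u))); last first.
          by move=> w /=; rewrite andb_idl // => /(subsetP (BuB u)).
        by apply: leq_sum => w /setIdP[].
      rewrite -sum_nat_const.
      apply: leq_trans (_ : \sum_(a in nbh e A u) #|nbh e B a| <= _); last first.
        by apply: leq_sum => a /setIdP[/dA].
      rewrite -(sum_card_swap (mem B) (mem (nbh e A u)) (fun w a => e a w)) /=.
      apply: leq_sum => w _; apply/subset_leq_card/subsetP => a; rewrite !inE.
      by rewrite -!andbA => /and4P[-> -> _ aw]; rewrite e_sym.
    move: cod gu; rewrite /theta /vt /good => cod gu.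
    have hD : 0 < 4 * h * D by rewrite muln_gt0 D0 andbT /h; move: E00; clear; lia.
    rewrite -(leq_pmul2l hD); move: cod gu; clear; nia.
  - move=> a aAu; apply: leq_trans (eA' _ (AuA _ _ aAu)); rewrite leq_mul2l; apply/orP; right.
    apply/subset_leq_card/subsetP => -[p q] /setIdP[]; rewrite in_setX => /andP[p1 p2] ep.
    by apply/setIdP; rewrite in_setX !(subsetP (nbhS e a (BuB u))).
have collect : \sum_(u in B) \sum_(a in Au u) #|rich_tuples e j (Au u) (nbh e (Bu u) a) M| <=
    \sum_(a in A) #|rich_tuples e j.+1 A (nbh e B a) M|.
  rewrite (exchange_big_dep (mem A)) /=; last by move=> u a _; apply: AuA.
  apply: leq_sum => a aA.
  rewrite (eq_bigl (mem [set u in B | a \in Au u])); last by move=> u; rewrite /= inE.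
  apply: rich_tuplesS => //.
  - by apply/subsetP => u /setIdP[uB /setIdP[/setIdP[_ ua] _]]; rewrite inE uB e_sym.
  - by move=> u _; apply/subsetP => b /setIdP[].
  - by move=> u _; apply/nbhS/BuB.
have total : \sum_(u in B | good u) #|Au u| * D ^ j <=
    E' * \sum_(u in B) \sum_(a in Au u) #|rich_tuples e j (Au u) (nbh e (Bu u) a) M|.
  rewrite [X in _ <= E' * X](bigID good) /= mulnDr; apply: leq_trans (leq_addr _ _).
  by rewrite big_distrr; apply: leq_sum => u /andP[]; apply: rec.
rewrite expnS mulnA; apply: leq_trans (leq_mul manyg (leqnn _)) _.
rewrite -mulnA big_distrl /=; apply: leq_trans (leq_mul (leqnn _) total) _.
apply: leq_trans (leq_mul (leqnn _) (leq_mul (leqnn _) collect)) _.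
by rewrite mulnA leq_mul2r -addnA leq_addr orbT.
Qed.

(** A bad vertex for [c = 2] sees more than half of [W], so [n] of them form a dense pair with [W].
    This replaces the factor [2 * s] of [kss_bad] by a constant. *)
Lemma no_dense_pair_bad (T : finType) (e : rel T) (n E : nat) (W : {set T}) :
  1 < E -> no_dense_pair e n E -> n <= #|W| -> #|bad_vertices e 2 W| < n.
Proof.
move=> E1 nd nW; rewrite ltnNge; apply/negP => nbad; apply: (nd _ _ nbad nW) => x.
rewrite inE cardsD => lt; have := subset_leq_card (subsetIl W (nbh e W x)).
have -> : W :&: nbh e W x = nbh e W x by apply/setIidPr; apply: nbh_sub.
move: lt; have -> : W :&: nbh e W x = nbh e W x by apply/setIidPr; apply: nbh_sub.
by clear -E1; nia.
Qed.

Lemma card_forget_tuples (T Q : finType) (N : {set T}) (p : Q) :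
  #|forget p @: tuples_in Q N| <= #|N| ^ #|Q|.-1.
Proof.
pose F q : {pred option T} := if q == p then pred1 None else mem (Some @: N).
apply: leq_trans (_ : #|family F| <= _).
  apply/subset_leq_card/subsetP => _ /imsetP[x xN ->]; apply/familyP => q.
  rewrite /F ffunE; case: eqP => _; first by rewrite inE.
  by apply: imset_f; move: xN; rewrite inE => /forallP.
rewrite card_family foldrE big_image /= (bigD1 p) //= {1}/F eqxx card1 mul1n.
rewrite (eq_bigr (fun=> #|N|)); last first.
  by move=> q /negPf qp; rewrite /F qp card_imset // => u v [].
by rewrite prod_nat_const (cardC1 p).
Qed.

Lemma card_rich_set (T Q : finType) (e : rel T) (k M : nat) (A N : {set T}) (I : {set Q}) :
  #|I| = k -> #|[set x in tuples_in Q N | M <= #|com e A x I|]| =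
  #|rich_tuples e k A N M| * #|N| ^ (#|Q| - k).
Proof.
move=> cI; have [sg sgI] := enum_image cI.
have sg_inj : injective sg.
  have /imset_injP inj : #|[set sg j | j : 'I_k]| == #|'I_k| by rewrite sgI card_ord cI.
  by move=> i j; apply: inj.
have RN : rich_tuples e k A N M \subset tuples_in 'I_k N by apply/subsetP => w /setIdP[].
have := card_pull sg_inj RN; rewrite card_ord => <-.
apply: eq_card => x; rewrite !inE (com_image _ _ _ sgI); case: forallP => //= xN.
by rewrite (introT forallP) // => j; rewrite ffunE.
Qed.

(* A random r-tuple of N makes a positive fraction of the lines of a fixed large linear design on r
   points rich, which leaves at least r lines. *)
Lemma rich_tuples_good (k E : nat) : 1 < k -> exists C, forall (T : finType) (e : rel T),
  symmetric e -> irreflexive e -> forall (n0 M : nat) (A N : {set T}), 0 < n0 ->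
  (forall W : {set T}, n0 <= #|W| -> #|bad_vertices e 2 W| <= n0) ->
  C * n0 <= M -> C * n0 <= #|N| -> C * #|inner_edges e N| <= #|N| ^ 2 ->
  #|N| ^ k <= E * #|rich_tuples e k A N M| -> has_good e k.
Proof.
move=> k1; have km : k <= 2 * E * k + k by apply: leq_addl.
(* With [q >= 2 * E * k], a fraction [1 / (2 * E)] of the [q ^ 2] lines is still at least the number
   [r] of points. *)
have [q [mq _ design]] := linear_design k1 km; pose r := k * q.
have [LL0 [cLL kLL linLL]] := design r (leqnn _).
exists (2 ^ r * (2 ^ (q ^ 2) * (q ^ 2 + 1)) + 8 * E * r ^ 2 + 4 * E * (2 ^ r * r) + 1).
move=> T e e_sym e_irr n0 M A N n00 badW CM CN inn many.
set n := #|N| in CN inn many.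
have n_gt0 : 0 < n by move: CN n00; clear; nia.
have E0 : 0 < E by case: (E) many => //; rewrite mul0n leqNgt expn_gt0 n_gt0.
have q0 : 0 < q by apply: leq_trans mq; move: k1; clear; lia.
have rk : k <= r by rewrite leq_pmulr.
have q2 : 0 < q ^ 2 by rewrite expn_gt0 q0.
have nr : n ^ r = n ^ (r - 2) * n ^ 2 by rewrite -expnD subnK // (leq_trans k1).
pose cnt (x : {ffun 'I_r -> T}) := #|[set I in LL0 | M <= #|com e A x I|]|.
pose Om1 := [set x in tuples_in 'I_r N | q ^ 2 <= 2 * E * cnt x].
(* No codegree reaches [#|T|.+1], so spread here means distinct and pairwise non-adjacent. *)
pose sp := spread_tuples e r A N #|T|.+1.
have sum_cnt : q ^ 2 * n ^ r <= E * \sum_(x in tuples_in 'I_r N) cnt x.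
  rewrite (sum_card_swap (mem (tuples_in 'I_r N)) (mem LL0) (fun x I => M <= #|com e A x I|)) /=.
  rewrite (eq_bigr (fun=> #|rich_tuples e k A N M| * n ^ (r - k))); last first.
    by move=> I IL; rewrite (card_rich_set e M A N (kLL _ IL)) card_ord.
  rewrite sum_nat_const cLL mulnCA leq_mul2l; apply/orP; right.
  by rewrite -{1}(subnKC rk) expnD mulnA leq_mul2r many orbT.
(* On average a fraction [1 / E] of the lines is rich, and tuples outside [Om1] account for at most
   half of that. *)
have cOm1 : n ^ r <= 2 * E * #|Om1|.
  have split : 2 * E * \sum_(x in tuples_in 'I_r N) cnt x <= 2 * E * (#|Om1| * q ^ 2) + q ^ 2 * n ^ r.
    rewrite (bigID (fun x => q ^ 2 <= 2 * E * cnt x)) /= mulnDr; apply: leq_add.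
      rewrite leq_mul2l; apply/orP; right; rewrite -sum_nat_const.
      rewrite [X in _ <= X](eq_bigl (fun x => (x \in tuples_in 'I_r N) && (q ^ 2 <= 2 * E * cnt x))); last first.
        by move=> x; rewrite inE.
      apply: leq_sum => x _; rewrite -cLL; apply/subset_leq_card/subsetP => I.
      by case/setIdP.
    apply: leq_trans (_ : \sum_(x in tuples_in 'I_r N) q ^ 2 <= _); last first.
      by rewrite sum_nat_const card_tuples_in card_ord mulnC.
    rewrite big_distrr [X in _ <= X](bigID (fun x => q ^ 2 <= 2 * E * cnt x)) /=.
    apply: leq_trans (leq_addl _ _); apply: leq_sum => x /andP[_].
    by rewrite -ltnNge => /ltnW.
  rewrite -(leq_pmul2l q2); move: split sum_cnt; clear; lia.
have cbad : 4 * E * #|tuples_in 'I_r N :\: sp| <= n ^ r.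
  have := spread_or_rich e #|T|.+1 A N (leq_trans k1 rk); rewrite -/n -/sp.
  have -> : #|rich_pairs e A N #|T|.+1| = 0.
    apply/eqP; rewrite cards_eq0 -subset0; apply/subsetP => p /setIdP[_].
    by rewrite leqNgt ltnS max_card.
  have spN : sp \subset tuples_in 'I_r N by apply/subsetP => x /setIdP[].
  rewrite cardsD (setIidPr spN) card_tuples_in card_ord -/n addn0 => le.
  apply: leq_trans (_ : 4 * E * (r ^ 2 * ((n + #|inner_edges e N|) * n ^ (r - 2))) <= _).
    by rewrite leq_mul2l; apply/orP; right; rewrite leq_subLR.
  have nn : 8 * E * r ^ 2 * n <= n ^ 2.
    rewrite -mulnn leq_mul2r; apply/orP; right; apply: leq_trans CN; move: n00; clear; nia.
  have ni : 8 * E * r ^ 2 * #|inner_edges e N| <= n ^ 2.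
    by apply: leq_trans inn; rewrite leq_mul2r; apply/orP; right; clear; lia.
  have : 4 * E * (r ^ 2 * (n + #|inner_edges e N|)) <= n ^ 2 by move: nn ni; clear; lia.
  move/(leq_mul (leqnn (n ^ (r - 2)))); rewrite nr; clear; lia.
pose Om := Om1 :&: sp.
have cOm : n ^ r <= 4 * E * #|Om|.
  have : #|Om1| <= #|Om| + #|tuples_in 'I_r N :\: sp|.
    rewrite -(cardsID sp Om1) leq_add2l; apply/subset_leq_card/setSD.
    by apply/subsetP => x /setIdP[].
  move: cOm1 cbad; clear; nia.
have [x xOm xgood] : exists2 x, x \in Om & forall I, 2 ^ #|'I_r| * n0 <= #|com e A x I| ->
    #|com e A x I| <= 2 ^ #|'I_r| * #|exact e A x I|.
  apply: (@good_point _ e e_sym _ A Om 2 n0 n0 (n ^ r.-1)) => //.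
    move=> p; rewrite -[r in X in _ <= _ ^ X.-1]card_ord.
    apply: leq_trans (card_forget_tuples N p); apply/subset_leq_card/imsetS.
    by apply/subsetP => x /setIP[/setIdP[]].
  have E4 : 0 < 4 * E by rewrite muln_gt0.
  rewrite card_ord -(ltn_pmul2l E4); apply: leq_trans cOm.
  have -> : n ^ r = n * n ^ r.-1 by rewrite -expnS (prednK (leq_trans (ltnW k1) rk)).
  rewrite !mulnA ltn_mul2r expn_gt0 n_gt0 /=.
  by apply: leq_trans CN; move: n00; clear; nia.
have [/setIdP[xN xcnt] /spread_tuplesP[_ xsp]] := setIP xOm.
pose LL := [set I in LL0 | M <= #|com e A x I|].
have LLb : #|LL| <= q ^ 2 by rewrite -cLL; apply/subset_leq_card/subsetP => I /setIdP[].
have rLL : r <= #|LL|.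
  have E2 : 0 < 2 * E by rewrite muln_gt0.
  rewrite -(leq_pmul2l E2); apply: leq_trans xcnt; rewrite /r mulnA -mulnn leq_mul2r.
  by rewrite (leq_trans _ mq) ?orbT // leq_addr.
apply: (@linear_embedding _ e e_sym e_irr k _ A x LL 2 n0 (n0 * (q ^ 2 + 1))) => //.
- exact: ltnW.
- by move=> i j E1; apply/eqP/negPn/negP => /xsp[]; rewrite E1 eqxx.
- by move=> p p'; have [->|/xsp[]//] := eqVneq p p'; rewrite e_irr.
- by move=> W sW; apply: badW; apply: leq_trans sW; rewrite leq_pmulr // addn1.
- by rewrite mulnC ltn_pmul2l // addn1 ltnS.
- by apply: leq_trans rLL; apply: leq_trans rk; apply: ltnW.
- by rewrite card_ord.
- by move=> I /setIdP[/kLL ->].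
- by move=> I I' /setIdP[IL _] /setIdP[I'L _]; apply: linLL.
move=> I /setIdP[IL IM]; have xg := xgood I; rewrite card_ord in xg.
have p0 : 0 < 2 ^ r by rewrite expn_gt0.
have big : 2 ^ r * (2 ^ (q ^ 2) * (q ^ 2 + 1)) * n0 <= #|com e A x I|.
  by apply: leq_trans IM; apply: leq_trans CM; rewrite leq_mul2r -!addnA leq_addr orbT.
rewrite -(leq_pmul2l p0); apply: leq_trans (xg _).
  apply: leq_trans big; rewrite -mulnA leq_mul2l; apply/orP; right.
  rewrite [n0 * _]mulnC mulnA leq_mul2r; apply/orP; right; rewrite leq_mul2r.
  by rewrite leq_pexp2l ?orbT.
apply: leq_trans big; rewrite -mulnA leq_mul2l leq_pmull ?orbT //.
by rewrite muln_gt0 expn_gt0 addn1.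
Qed.

(** * Proof of the theorem *)

(** Every quantifier ranges over a finite type, so the property is decidable and the case
    distinction is constructive. *)
Lemma has_good_dec (T : finType) (e : rel T) (k : nat) : has_good e k \/ ~ has_good e k.
Proof.
pose C4 (A : {set T}) := [exists a, exists b, exists c, exists d,
  [&& [&& a \in A, b \in A, c \in A & d \in A], uniq [:: a; b; c; d] &
      [&& e a b, e b c, e c d & e d a]]].
have C4P A : reflect (has_C4_in e A) (C4 A).
  apply: (iffP existsP) => [[a /existsP[b /existsP[c /existsP[d /and3P[h1 h2 h3]]]]]|].
    by exists a, b, c, d.
  case=> a [b [c [d [h1 h2 h3]]]]; exists a.
  by apply/existsP; exists b; apply/existsP; exists c; apply/existsP; exists d; apply/and3P.
case: (pickP [pred A : {set T} | [&& ~~ C4 A, A != set0 &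
    k * #|A| <= \sum_(x in A) deg_in e A x]]) => [A /and3P[/C4P h1 h2 h3]|none].
  by left; exists A.
right=> -[A [h1 [h2 h3]]].
have /negP[] := negbT (none A); apply/andP; split; last exact/andP.
by apply/negP => /C4P.
Qed.

Lemma no_dense_pairW (T : finType) (e : rel T) (n E E' : nat) :
  E' <= E -> no_dense_pair e n E -> no_dense_pair e n E'.
Proof.
move=> EE nd X Y nX nY h; apply: (nd X Y nX nY) => x xX; apply: leq_trans (h _ xX) _.
by rewrite leq_mul2r EE orbT.
Qed.

(** Take [D] the largest integer such that some set has average degree at least [D], and [S] a
    smallest such set. Deleting a vertex of degree below [D / 2] would keep the average degree at
    least [D]. Rounding to an integer accounts for [D.+1]. *)
Lemma densest_core (T : finType) (e : rel T) (d : nat) :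
  symmetric e -> irreflexive e -> 0 < d -> avgdeg_ge e d [set: T] ->
  exists D (S : {set T}), [/\ d <= D, S != set0, sparse e D.+1 &
    {in S, forall v, D <= 2 * #|nbh e S v|}].
Proof.
move=> e_sym e_irr d0 [T0 Td].
pose P D := [exists S : {set T}, (S != set0) && (D * #|S| <= \sum_(y in S) #|nbh e S y|)].
have Pd : P d by apply/existsP; exists [set: T]; rewrite T0.
have Pb D : P D -> D <= #|T|.
  case/existsP => S /andP[S0 h]; rewrite -(@leq_pmul2r #|S|) ?card_gt0 //.
  by apply: leq_trans h _; rewrite mulnC -sum_nat_const; apply: leq_sum => x _; apply: max_card.
have exP : exists D, P D by exists d.
case: (ex_maxnP exP Pb) => D /existsP[S0 S0P] maxD.
pose dense S := (S != set0) && (D * #|S| <= \sum_(y in S) #|nbh e S y|).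
case: (@arg_minnP _ S0 dense (fun S : {set T} => #|S|) S0P) => S /andP[Sne Sd] minS.
have dD : d <= D by apply: maxD.
exists D, S; split=> //.
  move=> Y; have [->|Y0] := eqVneq Y set0; first by rewrite big_set0.
  apply/ltnW; rewrite ltnNge; apply/negP => h.
  have /maxD : P D.+1 by apply/existsP; exists Y; rewrite Y0.
  by rewrite ltnn.
move=> v vS; rewrite leqNgt; apply/negP => lt.
have cS := cardsD1 v S; rewrite vS in cS.
have drop : \sum_(y in S) #|nbh e S y| <=
    \sum_(y in S :\ v) #|nbh e (S :\ v) y| + 2 * #|nbh e S v|.
  rewrite (bigD1 v) //= mulSn mul1n addnC addnA leq_add2r.
  rewrite (eq_bigl (mem (S :\ v))); last by move=> y; rewrite /= in_setD1 andbC.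
  apply: leq_trans (_ : \sum_(y in S :\ v) (#|nbh e (S :\ v) y| + e v y) <= _).
    apply: leq_sum => y yS; rewrite (cardsD1 v (nbh e S y)) addnC leq_add //.
      by apply/subset_leq_card/subsetP => z; rewrite !inE -!andbA.
    by rewrite inE vS e_sym.
  rewrite big_split leq_add2l /= -sum1_card.
  rewrite [X in _ <= X](bigID (mem (S :\ v))) /=; apply: leq_trans (leq_addr _ _).
  rewrite [X in _ <= X](eq_bigl (fun y => (y \in S :\ v) && e v y)); last first.
    by move=> y; rewrite !inE; case: (y == v); case: (y \in S); case: (e v y).
  by rewrite big_mkcondr; apply: leq_sum => y _; case: (e v y).
have [Sv0|Sv0] := eqVneq (S :\ v) set0.
  move: drop; rewrite Sv0 big_set0 add0n; move: cS Sd; rewrite Sv0 cards0 => ->.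
  rewrite muln1 => h1 h2; move: (leq_trans h1 h2) lt; clear; lia.
have /minS : (S :\ v != set0) && (D * #|S :\ v| <= \sum_(y in S :\ v) #|nbh e (S :\ v) y|).
  by rewrite Sv0 /=; move: drop lt Sd; rewrite cS; clear; lia.
by rewrite cS add1n ltnn.
Qed.

(** Fewer than [n0] vertices see a fraction [1 / (32 * E)] of [N]. Their degrees and those of the
    remaining vertices each contribute at most half of the bound. *)
Lemma few_inner_edges (T : finType) (e : rel T) (n0 E D : nat) (N : {set T}) :
  no_dense_pair e n0 (32 * E) -> 8 * E * n0 <= D -> n0 <= #|N| -> #|N| <= 4 * D ->
  E * #|inner_edges e N| <= D ^ 2.
Proof.
move=> nd nD nN N4.
pose X := [set u in N | #|N| <= 32 * E * #|nbh e N u|].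
have cX : #|X| < n0.
  by rewrite ltnNge; apply/negP => nX; apply: (nd _ _ nX nN) => x; rewrite inE => /andP[].
have inE' : #|inner_edges e N| = \sum_(u in N) #|nbh e N u|.
  exact: card_set_pairs.
have bound : 32 * E * #|inner_edges e N| <= #|X| * (32 * E * #|N|) + #|N| * #|N|.
  rewrite inE' big_distrr /= (bigID (mem X)) /=; apply: leq_add.
    rewrite (eq_bigl (mem X)); last by move=> u; rewrite /= andb_idl // => /setIdP[].
    rewrite -sum_nat_const; apply: leq_sum => u _.
    by rewrite leq_mul2l subset_leq_card ?orbT ?nbh_sub.
  rewrite -sum_nat_const [X in _ <= X](bigID (mem X)) /=; apply: leq_trans (leq_addl _ _).
  by apply: leq_sum => u /andP[uN]; rewrite inE uN /= -ltnNge => /ltnW.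
rewrite -(@leq_pmul2l 32) // mulnA; apply: leq_trans bound _.
have h1 : #|X| * (32 * E * #|N|) <= n0 * (32 * E * (4 * D)).
  by apply: leq_mul; [exact: ltnW|rewrite leq_mul2l N4 orbT].
have h2 : #|N| * #|N| <= 4 * D * (4 * D) by apply: leq_mul.
have h3 : 8 * E * n0 * D <= D * D by rewrite leq_mul2r nD orbT.
rewrite -mulnn; move: h1 h2 h3; clear; lia.
Qed.

Lemma no_dense_pair_good (k : nat) : 1 < k -> exists C E, forall (T : finType) (e : rel T),
  symmetric e -> irreflexive e -> forall n0 d : nat, 0 < n0 -> no_dense_pair e n0 E ->
  C * n0 <= d -> avgdeg_ge e d [set: T] -> has_good e k.
Proof.
move=> k1; have [rho [E2 [C2 rich]]] := many_rich_tuples k k1 4.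
(* The neighbourhood used at the end has at most [4 * D] vertices; comparing its size with [D] costs
   [4 ^ k]. *)
have [C3 final] := rich_tuples_good (4 ^ k * E2) k1.
(* The part [4 * rho] makes [A] at least [rho] times as large as [Hi]; the 7 covers the exceptional
   vertices, which cost [3 * #|Hi|] in [ALo]. *)
pose L := 4 * rho + 7; have [Er regular] := regular_good L (ltnW k1).
pose Ei := E2 + 16 * C3 + 1.
exists (C2 + 4 * C3 + Er + 16 * k + 8 * Ei + 4), (32 * Ei + L * Er).
move=> T e e_sym e_irr n0 d n00 nd Cd avg.
have d0 : 0 < d by apply: leq_trans Cd; rewrite muln_gt0 n00 addnS.
have [D [S [dD S0 sp minS]]] := densest_core e_sym e_irr d0 avg.
have {d d0 avg Cd dD}CD := leq_trans Cd dD.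
have cC c : c <= C2 + 4 * C3 + Er + 16 * k + 8 * Ei + 4 -> c * n0 <= D.
  by move=> le; apply: leq_trans CD; rewrite leq_mul2r le orbT.
have cC1 c : c <= C2 + 4 * C3 + Er + 16 * k + 8 * Ei + 4 -> c <= D.
  by move=> /cC; apply: leq_trans; rewrite leq_pmulr.
have D0 : 0 < D by apply: cC1; lia.
have [//|ng] := has_good_dec e k.
have nd2 : no_dense_pair e n0 2 by apply: no_dense_pairW nd; rewrite /Ei; lia.
have ndi : no_dense_pair e n0 (32 * Ei) by apply: no_dense_pairW nd; apply: leq_addr.
have ndr : no_dense_pair e n0 (L * Er) by apply: no_dense_pairW nd; apply: leq_addl.
have badW (W : {set T}) : n0 <= #|W| -> #|bad_vertices e 2 W| <= n0.
  by move=> nW; apply/ltnW/(no_dense_pair_bad _ nd2 nW).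
pose Hi := [set v in S | L * D < #|nbh e S v|]; pose Lo := S :\: Hi.
have HiS : Hi \subset S by apply/subsetP => v /setIdP[].
have cLo : #|S| = #|Hi| + #|Lo| by rewrite -(cardsID Hi S) (setIidPr HiS).
have cHi : L * #|Hi| <= 2 * #|S|.
  have : L * D * #|Hi| <= D.+1 * #|S|.
    apply: leq_trans (sp S); rewrite mulnC -sum_nat_const [X in _ <= X](bigID (mem Hi)) /=.
    apply: leq_trans (leq_addr _ _); rewrite [X in _ <= X](eq_bigl (mem Hi)); last first.
      by move=> v; rewrite /= andb_idl // => /(subsetP HiS).
    by apply: leq_sum => v /setIdP[_ /ltnW].
  by move: D0; clear; move=> D0 h; rewrite -(leq_pmul2l D0); move: h D0; nia.
have {cHi}cHi : 4 * (rho * #|Hi|) + 7 * #|Hi| <= 2 * #|S| by rewrite mulnA -mulnDl.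
have h7 : 7 * #|Hi| <= 2 * #|S| by apply: leq_trans cHi; apply: leq_addl.
have S1 : 0 < #|S| by rewrite card_gt0.
have degS v : #|nbh e S v| = #|nbh e Hi v| + #|nbh e Lo v|.
  rewrite -(cardsID Hi (nbh e S v)); congr (_ + _); apply: eq_card => y; rewrite !inE.
    by case: (y \in S); rewrite ?andbF ?andbT //= [RHS]andbC.
  by rewrite andbA.
pose Lo1 := [set v in Lo | D <= 4 * #|nbh e Lo v|].
have Lo1Lo : Lo1 \subset Lo by apply/subsetP => v /setIdP[].
have [half|half] := leqP #|Lo| (2 * #|Lo1|).
  apply: (regular T e e_sym e_irr n0 D Lo) => //.
  - by rewrite mulnC; apply: cC; lia.
  - by apply: cC1; lia.
  - by rewrite -card_gt0; move: h7 cLo S1; clear; lia.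
  - move=> v /setDP[vS]; rewrite inE vS -leqNgt /=; apply: leq_trans.
    by rewrite degS leq_addl.
  - have : #|Lo1| * D <= 4 * \sum_(v in Lo) #|nbh e Lo v|.
      rewrite -sum_nat_const big_distrr /= [X in _ <= X](bigID (mem Lo1)) /=.
      apply: leq_trans (leq_addr _ _); rewrite [X in _ <= X](eq_bigl (mem Lo1)); last first.
        by move=> v; rewrite /= andb_idl // => /(subsetP Lo1Lo).
      by apply: leq_sum => v /setIdP[].
    by move: half; clear; nia.
(* These vertices have degree at least [D / 2] in [S] but less than [D / 4] in [Lo], hence more than
   [D / 4] in [Hi]. *)
pose Lo2 := Lo :\: Lo1; pose A := [set a in Lo2 | #|nbh e Hi a| <= 4 * D].
have AS a : a \in A -> [/\ a \in S, D <= 4 * #|nbh e Hi a| & #|nbh e Hi a| <= 4 * D].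
  case/setIdP=> /setDP[aLo]; rewrite inE aLo /= -ltnNge => lt le.
  have aS : a \in S by case/setDP: aLo.
  by split=> //; have := minS _ aS; rewrite degS; lia.
have cLo2 : #|Lo| = #|Lo1| + #|Lo2| by rewrite -(cardsID Lo1 Lo) (setIidPr Lo1Lo).
have AL : A \subset Lo2 by apply/subsetP => v /setIdP[].
have cA : #|Lo2| = #|A| + #|Lo2 :\: A| by rewrite -(cardsID A Lo2) (setIidPr AL).
(* If more than [#|Hi|] vertices had over [4 * D] neighbours in [Hi], their union with [Hi] would be
   too dense for [sparse]. *)
have cLA : #|Lo2 :\: A| <= #|Hi|.
  pose Z := (Lo2 :\: A) :|: Hi.
  have cZ : #|Z| <= #|Lo2 :\: A| + #|Hi| by apply: leq_card_setU.
  have : #|Lo2 :\: A| * (4 * D) <= D.+1 * #|Z|.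
    apply: leq_trans (sp Z); rewrite -sum_nat_const [X in _ <= X](bigID (mem (Lo2 :\: A))) /=.
    apply: leq_trans (leq_addr _ _).
    rewrite [X in _ <= X](eq_bigl (mem (Lo2 :\: A))); last first.
      by move=> v; rewrite /= andb_idl // => h; apply/setUP; left.
    apply: leq_sum => v /setDP[vL]; rewrite inE vL /= -ltnNge => /ltnW le.
    by apply: leq_trans le _; apply/subset_leq_card/nbhS/subsetUr.
  by move: cZ D0; clear; nia.
have ALo : #|S| <= 2 * #|A| + 3 * #|Hi| by move: half cLo cLo2 cA cLA; clear; lia.
have rhoA : rho * #|Hi| <= #|A| by move: ALo cHi; clear; lia.
have A0 : A != set0 by rewrite -card_gt0; move: ALo h7 S1; clear; lia.
have nHi a : a \in A -> n0 <= #|nbh e Hi a| /\ C3 * n0 <= #|nbh e Hi a|.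
  case/AS => _ le _; have h1 := cC (4 * C3) ltac:(lia); have h2 := cC 4 ltac:(lia).
  by move: le h1 h2; clear; nia.
have inn a : a \in A -> Ei * #|inner_edges e (nbh e Hi a)| <= D ^ 2.
  move=> aA; have [_ _ le4] := AS _ aA; have [nN _] := nHi _ aA.
  by apply: few_inner_edges ndi _ nN le4; apply: cC; lia.
have many : #|A| * D ^ k <= E2 * \sum_(a in A) #|rich_tuples e k A (nbh e Hi a) D|.
  apply: rich => //; first by apply: cC1; lia.
  - by move=> a /AS[].
  - by move=> a /AS[].
  - by move=> a /inn; apply: leq_trans; rewrite leq_mul2r /Ei; lia.
have [a0 a0A richN] : exists2 a, a \in A & D ^ k <= E2 * #|rich_tuples e k A (nbh e Hi a) D|.
  case: (pickP [pred a in A | D ^ k <= E2 * #|rich_tuples e k A (nbh e Hi a) D|]).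
    by move=> a /andP[]; exists a.
  move=> none; have : \sum_(a in A) (E2 * #|rich_tuples e k A (nbh e Hi a) D|).+1 <= \sum_(a in A) D ^ k.
    by apply: leq_sum => a aA; have := none a; rewrite /= aA /= => /negbT; rewrite -ltnNge.
  have A1 : 0 < #|A| by rewrite card_gt0.
  under eq_bigr do rewrite -addn1.
  rewrite big_split /= -big_distrr !sum_nat_const muln1 /= => h; have := leq_trans h many.
  by rewrite -[X in _ <= X]addn0 leq_add2l leqNgt A1.
have [_ ge4 le4] := AS _ a0A; have [nN CN] := nHi _ a0A.
apply: (final T e e_sym e_irr n0 D A (nbh e Hi a0)) => //.
- by apply: cC; lia.
- have := inn _ a0A; rewrite /Ei -!mulnn; move: ge4; clear; nia.
rewrite -mulnA; apply: leq_trans (leq_mul (leqnn _) richN).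
by rewrite -expnMn leq_exp2rw.
Qed.

Theorem theorem1p6 (k : nat) (hk : 1 <= k) :
  exists s0 : nat, forall s : nat, s0 <= s ->
    forall (T : finType) (e : rel T),
      symmetric e -> irreflexive e ->
      ~ has_Kss e s ->
      avgdeg_ge e (s ^ (1000 * k ^ 2)) [set: T] ->
      exists A : {set T}, ~ has_C4_in e A /\ avgdeg_ge e k A.
Proof.
(* The argument runs with [k.+1], which exceeds 1 even for [k = 1]; the exponent has room, as
   [100 * k.+1 ^ 2 + 1 <= 1000 * k ^ 2]. *)
have k1 : 1 < k.+1 by [].
have [C [E sparse_case]] := no_dense_pair_good k1.
have [s1 dense_case] := @dense_good k.+1 E k1.
exists (s1 + C + 2) => s sbig T e e_sym e_irr nK avg.
have s0 : 0 < s by lia.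
suff [A [nC [A0 dA]]] : has_good e k.+1.
  exists A; split=> //; split=> //; apply: leq_trans dA.
  by rewrite leq_mul2r leqnSn orbT.
have [//|ng] := has_good_dec e k.+1.
apply: (sparse_case T e e_sym e_irr (s ^ (100 * k.+1 ^ 2)) (s ^ (1000 * k ^ 2))) => //.
- by rewrite expn_gt0 s0.
- move=> X Y nX nY h; apply: ng.
  by apply: (dense_case s _ T e e_sym e_irr nK X Y nX nY h); lia.
(* One additional factor [s] pays for the constant [C]. *)
apply: leq_trans (_ : s ^ (100 * k.+1 ^ 2).+1 <= _).
  by rewrite expnS leq_mul2r; apply/orP; right; lia.
by rewrite leq_pexp2l // -!mulnn; move: hk; clear; nia.
Qed.
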